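(* There is an absolute constant $c>0$ such that the following holds. Let $d\ge1$, $r\le 1/2$, $\eta\in(0,1/2)$, $\delta\in(0,1)$, let $\phi=\min(\eta,\tfrac12-\eta)$, and suppose $$N\ge \frac{16}{(cr)^d\phi^2}\left(\ln\frac{8}{(cr)^d\phi^2}+\ln\frac1\delta\right).$$ Then with probability at least $1-\delta$ there exists an ordering (permutation) $\pi$ of the sensors such that asynchronous best-response updates in the order $\pi$ cause all sensors to end in the same state (regardless of how ties are broken).
   Context: Sensors $1,\dots,N$ have positions $x_1,\dots,x_N$ drawn i.i.d. uniformly from the unit ball $\{x\in\mathbb{R}^d:\|x\|\le 1\}$. The target separator is the hyperplane $\{x: w\cdot x=0\}$ for a fixed unit vector $w$, and the target label of $x$ is $t(x)=\mathrm{sign}(w\cdot x)$. Here the noise rate is exactly $\eta$: conditional on the positions, the initial states in $\{+1,-1\}$ are independent, and sensor $i$'s initial state equals $t(x_i)$ with probability $1-\eta$ and equals $-t(x_i)$ with probability $\eta$. Distinct sensors $i\ne j$ are neighbors if $\|x_i-x_j\|\le r$. A best-response update of sensor $i$ sets its state to the majority state among its neighbors' current states (ties broken arbitrarily). Asynchronous updates in order $\pi$: sensors $\pi(1),\pi(2),\dots,\pi(N)$ each perform one best-response update, one at a time, each using the states current at the time of its update. *)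

(* Defs.v *)
From mathcomp Require Import all_boot all_order all_algebra all_fingroup.
From mathcomp Require Import all_classical all_reals all_analysis.
Set Implicit Arguments.
Unset Strict Implicit.
Unset Printing Implicit Defensive.
Import Order.TTheory GRing.Theory Num.Theory.
Local Open Scope classical_set_scope.
Local Open Scope ring_scope.

Section Sensors.
Variable R : realType.

(** n-fold product of a (raw) measure, defined by iterated integration
    (Tonelli): for A a set of n.+1-tuples,
    (m^n.+1)(A) = \int m(dx) (m^n)({t | x :: t \in A}). *)
Fixpoint iprod {dT} (T : measurableType dT) (m : set T -> \bar R) (n : nat)
  : set (n.-tuple T) -> \bar R :=
  match n return set (n.-tuple T) -> \bar R with
  | 0 => fun A => if `[< A [tuple] >] then 1%E else 0%E
  | n'.+1 => fun A =>
      (\int[m]_x @iprod dT T m n' [set t | A (@cons_tuple n' T x t)])%E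
  end.
Arguments iprod {dT T} m n _.

Definition lebesgue_d (d : nat) : set (d.-tuple R) -> \bar R :=
  @iprod _ (measurableTypeR R) (@lebesgue_measure R) d.

Definition dotp (d : nat) (x y : d.-tuple R) : R :=
  \sum_(k < d) tnth x k * tnth y k.
Definition enorm (d : nat) (x : d.-tuple R) : R := Num.sqrt (dotp x x).
Definition edist (d : nat) (x y : d.-tuple R) : R :=
  Num.sqrt (\sum_(k < d) (tnth x k - tnth y k) ^+ 2).

Definition unit_ball (d : nat) : set (d.-tuple R) := [set x | enorm x <= 1].

(** Target label t(x) = sign(w . x); states are booleans, true = +1,
    false = -1.  On the (null) hyperplane w . x = 0 we use +1. *)
Definition target (d : nat) (w x : d.-tuple R) : bool := 0 <= dotp w x.

Definition neighb (d N : nat) (r : R) (xs : N.-tuple (d.-tuple R))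
  (i j : 'I_N) : bool :=
  (i != j) && (edist (tnth xs i) (tnth xs j) <= r).

Definition best_response (d N : nat) (r : R) (xs : N.-tuple (d.-tuple R))
  (s : 'I_N -> bool) (i : 'I_N) (tb : bool) : bool :=
  let np := #|[pred j | neighb r xs i j && s j]| in
  let nm := #|[pred j | neighb r xs i j && ~~ s j]| in
  if (nm < np)%N then true else if (np < nm)%N then false else tb.

Definition update (d N : nat) (r : R) (xs : N.-tuple (d.-tuple R))
  (s : 'I_N -> bool) (i : 'I_N) (tb : bool) : 'I_N -> bool :=
  fun j => if j == i then best_response r xs s i tb else s j.

(** Asynchronous updates in the order pi(0), ..., pi(N-1), each sensor using
    the current states; [tb i] is the tie-breaking choice used by sensor i
    at its (unique) update. *)
Definition async_run (d N : nat) (r : R) (xs : N.-tuple (d.-tuple R))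
  (pi : 'S_N) (tb : 'I_N -> bool) (s0 : 'I_N -> bool) : 'I_N -> bool :=
  foldl (fun s k => update r xs s (pi k) (tb (pi k))) s0 (enum 'I_N).

Definition consensus_order_exists (d N : nat) (r : R)
  (xs : N.-tuple (d.-tuple R)) (s0 : 'I_N -> bool) : Prop :=
  exists pi : 'S_N, forall tb : 'I_N -> bool,
    exists b : bool, forall i : 'I_N, async_run r xs pi tb s0 i = b.

(** Conditional probability (given positions) of the initial-state vector
    s0 under exact noise rate eta: independent, s0 i = t(x_i) w.p. 1 - eta. *)
Definition noise_weight (d N : nat) (eta : R) (w : d.-tuple R)
  (xs : N.-tuple (d.-tuple R)) (s0 : {ffun 'I_N -> bool}) : R :=
  \prod_(i < N) (if s0 i == target w (tnth xs i) then 1 - eta else eta).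

(** Probability of the good event: positions i.i.d. uniform on the unit ball,
    then noisy initial states:
      P = (1 / vol(B)^N) \int_{B^N} \sum_{s0} weight(xs, s0) 1[good] dxs. *)
Definition prob_consensus (d N : nat) (r eta : R) (w : d.-tuple R) : \bar R :=
  ((\int[iprod (@lebesgue_d d) N]_(xs in [set xs | forall i : 'I_N,
        @unit_ball d (tnth xs i)])
     (\sum_(s0 : {ffun 'I_N -> bool})
        noise_weight eta w xs s0 *
        (if `[< consensus_order_exists r xs s0 >] then 1 else 0))%:E)
   * ((fine (@lebesgue_d d (@unit_ball d)) ^+ N)^-1)%:E)%E.

End Sensors.

(* Main.v *)
Require Import Defs.
From HB Require Import structures.
From mathcomp Require Import all_boot all_order all_algebra all_fingroup.
From mathcomp Require Import all_classical all_reals all_analysis.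
From mathcomp Require Import measurable_realfun ring lra.
Set Implicit Arguments.
Unset Strict Implicit.
Unset Printing Implicit Defensive.
Import Order.TTheory GRing.Theory Num.Theory.
Local Open Scope classical_set_scope.
Local Open Scope ring_scope.

(** Update the sensors in order of decreasing [w . x]. When sensor i is updated,
the sensors strictly above it are already +, and the others are + at least
where they were initially; so all sensors end + provided that, for every i, the
neighbours of i that are above i or initially + outnumber the remaining ones.

Fix i and [x_i]. The other sensors contribute i.i.d. votes Z in {1, 0, -1} (the
neighbours just described, non-neighbours, remaining neighbours), so by Chernoff
sensor i fails with probability at most [(E exp (- l Z)) ^ (N - 1)]. Let U, P, Q
be the parts of the neighbourhood of [x_i] above [x_i]; not above but in
[w . y >= 0]; not above and in [w . y < 0]. Reflection in the hyperplane
[w . y = min (w . x_i) 0] maps Q into U + P up to a null set, and stays in the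
unit ball, hence vol Q <= vol U + vol P. If [w . x_i <= 1/2], then U contains a
ball of radius r/32; otherwise Q is empty. Either way, for l of order
[phi / 32 ^ d], [E exp (- l Z) <= 1 - 2 (c r) ^ d phi ^ 2], and a union bound
over i concludes. *)

(** * Finite powers of a measure *)

Definition tcons {T : Type} n (p : T * n.-tuple T) : n.+1.-tuple T :=
  cons_tuple p.1 p.2.

Lemma measurable_tcons {dT} {T : measurableType dT} n :
  measurable_fun [set: T * n.-tuple T] (@tcons T n).
Proof. exact: measurable_cons. Qed.

Section iprod_succ.
Context {R : realType} {dT : measure_display} {T : measurableType dT} {n : nat}.
Variables (m : {sigma_finite_measure set T -> \bar R})
  (mu : {sigma_finite_measure set (n.-tuple T) -> \bar R}).
Local Open Scope ereal_scope.

(** Transports the binary product to [n.+1]-tuples: the successor step in identifying [iprod] with a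
    sigma-finite measure. *)
Definition pmcons : set (n.+1.-tuple T) -> \bar R :=
  pushforward (m \x mu) (@tcons T n).

Let pmcons0 : pmcons set0 = 0.
Proof. by rewrite /pmcons /pushforward preimage_set0 measure0. Qed.

Let pmcons_ge0 A : 0 <= pmcons A.
Proof. exact: (measure_ge0 (m \x mu)). Qed.

Let pmcons_sigma_additive : semi_sigma_additive pmcons.
Proof.
have mt := @measurable_tcons _ T n.
by apply: (@measure_semi_sigma_additive _ _ _ (pushforward (m \x mu) (@tcons T n))).
Qed.

HB.instance Definition _ := isMeasure.Build _ _ _ pmcons
  pmcons0 pmcons_ge0 pmcons_sigma_additive.

Let pmcons_sigma_finite : sigma_finite setT pmcons.
Proof.
have /sigma_finiteP[F [TF ndF Foo]] := sigma_finiteT m.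
have /sigma_finiteP[G [TG ndG Goo]] := sigma_finiteT mu.
pose unc (t : n.+1.-tuple T) : T * n.-tuple T := (thead t, behead_tuple t).
have munc : measurable_fun setT unc.
  apply/measurable_fun_pair; first exact: measurable_tnth.
  exact: measurable_behead.
(* Diagonal rectangles [F k] x [G k] suffice for a cover because both sequences are
   nondecreasing. *)
exists (fun k => unc @^-1` (F k `*` G k)).
  rewrite -preimage_bigcup; apply/esym/seteqP; split => // t _ /=.
  have [i _ Fi] : (\bigcup_i F i) (unc t).1 by rewrite -TF.
  have [j _ Gj] : (\bigcup_i G i) (unc t).2 by rewrite -TG.
  exists (maxn i j) => //; split.
    by move: Fi; apply/subsetPset/ndF/leq_maxl.
  by move: Gj; apply/subsetPset/ndG/leq_maxr.
move=> k; have [mF Fk] := Foo k; have [mG Gk] := Goo k; split.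
  by rewrite -[X in measurable X]setTI; apply: munc => //; exact: measurableX.
rewrite /pmcons /pushforward -comp_preimage.
suff -> : unc \o @tcons T n = id.
  by rewrite preimage_id product_measure1E// lte_mul_pinfty// ge0_fin_numE.
by apply/funext => -[x t]; rewrite /unc /=; congr pair; exact: val_inj.
Qed.

HB.instance Definition _ := Measure_isSigmaFinite.Build _ _ _ pmcons
  pmcons_sigma_finite.

Definition pmcons_measure : {sigma_finite_measure set (n.+1.-tuple T) -> \bar R} :=
  pmcons.
End iprod_succ.

Section iprod_measure.
Context {R : realType} {dT : measure_display} {T : measurableType dT}.
Variable m : {sigma_finite_measure set T -> \bar R}.
Local Open Scope ereal_scope.
Local Notation "m ^%P n" := (@iprod _ _ _ m n) (at level 30).

Lemma iprod_succE n (A : set (n.+1.-tuple T)) :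
  (m ^%P n.+1) A = (m \x (m ^%P n)) (@tcons T n @^-1` A).
Proof.
rewrite /product_measure1 /=; apply: eq_integral => x _ /=; congr ((m ^%P n) _).
by apply/seteqP; split => t /=; rewrite /xsection /= inE.
Qed.

(** [iprod] is a recursively defined set function; by induction it coincides with a sigma-finite
    measure (a Dirac mass for n = 0, then [pmcons]), and the measure axioms transfer to it by
    rewriting. *)
Lemma iprod_measure_ex n :
  exists mu : {sigma_finite_measure set (n.-tuple T) -> \bar R}, m ^%P n = mu.
Proof.
elim: n => [|n [mu IH]].
  exists (\d_([tuple])); apply/funext => A /=; rewrite diracE.
  by case: asboolP => h; [rewrite mem_set|rewrite memNset].
exists (pmcons_measure m mu); apply/funext => A.
by rewrite iprod_succE IH.
Qed.

Let iprod0 n : (m ^%P n) set0 = 0.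
Proof. by have [mu ->] := iprod_measure_ex n; exact: measure0. Qed.

Let iprod_ge0 n A : 0 <= (m ^%P n) A.
Proof. by have [mu ->] := iprod_measure_ex n; exact: measure_ge0. Qed.

Let iprod_sigma_additive n : semi_sigma_additive (m ^%P n).
Proof. by have [mu ->] := iprod_measure_ex n; exact: measure_semi_sigma_additive. Qed.

HB.instance Definition _ n := isMeasure.Build _ _ _ (m ^%P n)
  (@iprod0 n) (@iprod_ge0 n) (@iprod_sigma_additive n).

Let iprod_sigma_finite n : sigma_finite setT (m ^%P n).
Proof. by have [mu ->] := iprod_measure_ex n; exact: sigma_finiteT. Qed.

HB.instance Definition _ n := Measure_isSigmaFinite.Build _ _ _ (m ^%P n)
  (@iprod_sigma_finite n).

Lemma integral_iprod0 (f : 0.-tuple T -> \bar R) :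
  (forall t, 0 <= f t) -> \int[m ^%P 0]_t f t = f [tuple].
Proof.
move=> f0; rewrite (eq_integral (cst (f [tuple]))); last first.
  by move=> t _; rewrite (tuple0 t).
by rewrite integral_cst//= asboolT// mule1.
Qed.

Lemma integral_iprodS n (f : n.+1.-tuple T -> \bar R) :
  measurable_fun [set: n.+1.-tuple T] f -> (forall t, 0 <= f t) ->
  \int[m ^%P n.+1]_t f t = \int[m]_x \int[m ^%P n]_t f (tcons (x, t)).
Proof.
move=> mf f0.
transitivity (\int[pushforward (m \x (m ^%P n)) (@tcons T n)]_t f t).
  by congr integral; apply/funext => A; rewrite iprod_succE.
rewrite (ge0_integral_pushforward (@measurable_tcons _ T n))//; last first.
rewrite preimage_setT fubini_tonelli1//.
- by apply: measurableT_comp => //; exact: measurable_tcons.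
- by move=> x /=; exact: f0.
Qed.

Lemma integral_iprodS2 n (f : n.+1.-tuple T -> \bar R) :
  measurable_fun [set: n.+1.-tuple T] f -> (forall t, 0 <= f t) ->
  \int[m ^%P n.+1]_t f t = \int[m ^%P n]_t \int[m]_x f (tcons (x, t)).
Proof.
move=> mf f0; rewrite integral_iprodS//.
rewrite (fubini_tonelli (f \o @tcons T n))//.
- by apply: measurableT_comp => //; exact: measurable_tcons.
- by move=> x /=; exact: f0.
Qed.

End iprod_measure.

Lemma prod_neq_ord0 (R : comPzRingType) n (G : 'I_n.+1 -> R) :
  \prod_(j < n.+1 | j != ord0) G j = \prod_(j < n) G (lift ord0 j).
Proof. by rewrite big_mkcond big_ord_recl /= mul1r. Qed.

Lemma prod_neq_lift (R : comPzRingType) n (G : 'I_n.+1 -> R) (i : 'I_n) :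
  \prod_(j < n.+1 | j != lift ord0 i) G j =
  G ord0 * \prod_(j < n | j != i) G (lift ord0 j).
Proof.
by rewrite big_mkcond big_ord_recl /= [in RHS]big_mkcond.
Qed.

Section iprod_integrals.
Context {R : realType} {dT : measure_display} {T : measurableType dT}.
Variable m : {sigma_finite_measure set T -> \bar R}.
Local Open Scope ereal_scope.
Local Notation "m ^%P n" := (@iprod _ _ _ m n) (at level 30).

Lemma tcons0 n x (t : n.-tuple T) : tnth (tcons (x, t)) ord0 = x.
Proof. by []. Qed.

Lemma tconsS n x (t : n.-tuple T) i : tnth (tcons (x, t)) (lift ord0 i) = tnth t i.
Proof. by rewrite /tcons /= tnthS. Qed.

Lemma measurable_prod_tnth n (h : T -> R) : measurable_fun setT h ->
  measurable_fun [set: n.-tuple T] (fun t => (\prod_(j < n) h (tnth t j))%R).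
Proof.
move=> mh; apply: measurable_prod => j _.
by apply: measurableT_comp => //; exact: measurable_tnth.
Qed.

Lemma integral_iprod_prod n (h : T -> R) (Q : R) : measurable_fun setT h ->
  (forall x, (0 <= h x)%R) -> \int[m]_x (h x)%:E = Q%:E ->
  \int[m ^%P n]_t (\prod_(j < n) h (tnth t j))%:E = (Q ^+ n)%:E.
Proof.
move=> mh h0 hQ; elim: n => [|n IH].
  by rewrite integral_iprod0 ?big_ord0 ?expr0// => t; rewrite big_ord0.
have mP := measurable_prod_tnth (n := n) mh.
rewrite integral_iprodS; last 2 first.
- by apply/measurable_EFinP; apply: measurable_prod_tnth.
- by move=> t; rewrite lee_fin; apply: prodr_ge0.
under eq_integral => x _.
  under eq_integral => t _.
    rewrite big_ord_recl tcons0 EFinM.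
    under eq_bigr => j _ do rewrite tconsS.
    over.
  rewrite ge0_integralZl//.
  - rewrite IH muleC; over.
  - exact/measurable_EFinP.
  - by move=> t _; rewrite lee_fin; apply: prodr_ge0.
  - by rewrite lee_fin.
have Q0 : (0 <= Q)%R.
  by rewrite -lee_fin -hQ; apply: integral_ge0 => x _; rewrite lee_fin.
rewrite ge0_integralZl//; last 3 first.
- exact/measurable_EFinP.
- by move=> x _; rewrite lee_fin.
- by rewrite lee_fin exprn_ge0.
by rewrite hQ -EFinM exprSr.
Qed.

Lemma measurable_kernel_prod n (a : T -> R) (k : T * T -> R) (i : 'I_n) :
  measurable_fun setT a -> measurable_fun setT k ->
  measurable_fun [set: n.-tuple T]
    (fun t => (a (tnth t i) * \prod_(j < n | j != i) k (tnth t i, tnth t j))%R).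
Proof.
move=> ma mk; apply: measurable_funM.
  by apply: measurableT_comp => //; exact: measurable_tnth.
under eq_fun do rewrite big_mkcond.
apply: measurable_prod => j _; case: (j != i) => //.
apply: measurableT_comp => //.
by apply/measurable_fun_pair; exact: measurable_tnth.
Qed.

(** When i is not the first coordinate, the first coordinate is integrated first. *)
Lemma integral_iprod_kernel_le n (a : T -> R) (k : T * T -> R) (Q v : R) (i : 'I_n.+1) :
  measurable_fun setT a -> (forall x, (0 <= a x)%R) ->
  measurable_fun setT k -> (forall z, (0 <= k z)%R) ->
  (forall x, \int[m]_y (k (x, y))%:E <= Q%:E) ->
  \int[m]_x (a x)%:E = v%:E ->
  \int[m ^%P n.+1]_t
    (a (tnth t i) * \prod_(j < n.+1 | j != i) k (tnth t i, tnth t j))%:E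
  <= (v * Q ^+ n)%:E.
Proof.
move=> ma a0 mk k0 kQ av; elim: n i => [|n IH] i.
  rewrite ord1 integral_iprodS; last 2 first.
  - by apply/measurable_EFinP; apply: measurable_kernel_prod.
  - by move=> t; rewrite lee_fin mulr_ge0// prodr_ge0.
  rewrite expr0 mulr1 -av; rewrite le_eqVlt; apply/orP; left; apply/eqP/eq_integral => x _.
  rewrite integral_iprod0 => [|t]; first last.
    by rewrite lee_fin mulr_ge0// prodr_ge0.
  rewrite big_pred0 ?mulr1// => j; rewrite ord1 eqxx//.
have Q0 : (0 <= Q)%R.
  rewrite -lee_fin; apply: le_trans (kQ point).
  by apply: integral_ge0 => x _; rewrite lee_fin.
have mkx x : measurable_fun setT (fun y => k (x, y)).
  by apply: measurableT_comp => //; exact: measurable_pair1.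
pose F i (t : n.+2.-tuple T) :=
  (a (tnth t i) * \prod_(j < n.+2 | j != i) k (tnth t i, tnth t j))%:E.
have mF j : measurable_fun [set: n.+2.-tuple T] (F j).
  by apply/measurable_EFinP; apply: measurable_kernel_prod.
have F0 j t : 0 <= F j t by rewrite lee_fin mulr_ge0// prodr_ge0.
case: (unliftP ord0 i) => [i'|] ->.
  rewrite integral_iprodS2; last 2 first.
  - by apply/measurable_EFinP; apply: measurable_kernel_prod.
  - by move=> t; rewrite lee_fin mulr_ge0// prodr_ge0.
  have mky x : measurable_fun setT (fun y => k (y, x)).
    by apply: measurableT_comp => //; exact: measurable_pair2.
  rewrite exprSr mulrA EFinM.
  apply: (@le_trans _ _ (\int[m ^%P n.+1]_t
      ((a (tnth t i') * \prod_(j < n.+1 | j != i') k (tnth t i', tnth t j))%:E * Q%:E))).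
    apply: ge0_le_integral => //.
    - by move=> t _; apply: integral_ge0 => x _; rewrite lee_fin mulr_ge0// prodr_ge0.
    - apply: (@measurable_fun_fubini_tonelli_G _ _ _ _ _ m
        (F (lift ord0 i') \o @tcons T n.+1)) => [|z]; last exact: F0.
      by apply: measurableT_comp => //; exact: measurable_tcons.
    - apply: emeasurable_funM => //.
      by apply/measurable_EFinP; apply: measurable_kernel_prod.
    - move=> t _.
      under eq_integral => x _.
        rewrite (prod_neq_lift (fun j => k (_, tnth _ j))) tconsS tcons0.
        under eq_bigr => j _ do rewrite tconsS.
        rewrite mulrCA mulrC EFinM.
        over.
      rewrite ge0_integralZl//.
      + apply: lee_wpmul2l; first by rewrite lee_fin mulr_ge0// prodr_ge0.
        exact: kQ.
      + exact/measurable_EFinP.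
      + by move=> x _; rewrite lee_fin.
      + by rewrite lee_fin mulr_ge0// prodr_ge0.
  rewrite ge0_integralZr//; last 2 first.
  - by apply/measurable_EFinP; apply: measurable_kernel_prod.
  - by move=> t _; rewrite lee_fin mulr_ge0// prodr_ge0.
  by apply: lee_wpmul2r => //; rewrite lee_fin.
(* Remaining case: [i] is the first coordinate. With it fixed at x, the other coordinates contribute
   a power of one integral of [k (x, _)]. *)
rewrite integral_iprodS; last 2 first.
- by apply/measurable_EFinP; apply: measurable_kernel_prod.
- by move=> t; rewrite lee_fin mulr_ge0// prodr_ge0.
rewrite EFinM.
apply: (@le_trans _ _ (\int[m]_x ((a x)%:E * (Q ^+ n.+1)%:E))); last first.
  rewrite ge0_integralZr//; first by rewrite av.
  - exact/measurable_EFinP.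
  - by move=> x _; rewrite lee_fin.
  - by rewrite lee_fin exprn_ge0.
apply: ge0_le_integral => //.
- by move=> t _; apply: integral_ge0 => x _; rewrite lee_fin mulr_ge0// prodr_ge0.
- apply: (@measurable_fun_fubini_tonelli_F _ _ _ _ _ (m ^%P n.+1)
    (F ord0 \o @tcons T n.+1)) => [|z]; last exact: F0.
  by apply: measurableT_comp => //; exact: measurable_tcons.
- apply: emeasurable_funM => //.
  exact/measurable_EFinP.
- move=> x _.
  under eq_integral => t _.
    rewrite (prod_neq_ord0 (fun j => k (_, tnth _ j))) tcons0.
    under eq_bigr => j _ do rewrite tconsS.
    rewrite EFinM.
    over.
  rewrite ge0_integralZl//.
  + apply: lee_wpmul2l; first by rewrite lee_fin.
    have kfin : \int[m]_y (k (x, y))%:E \is a fin_num.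
      rewrite ge0_fin_numE; first exact: le_lt_trans (kQ x) (ltry _).
      by apply: integral_ge0 => y _; rewrite lee_fin.
    rewrite (integral_iprod_prod n.+1 (h := fun y => k (x, y))
       (Q := fine (\int[m]_y (k (x, y))%:E)))//; last by rewrite fineK.
    rewrite lee_fin; apply: lerXn2r; rewrite ?nnegrE//.
    * by apply/fine_ge0/integral_ge0 => y _; rewrite lee_fin.
    * by rewrite -lee_fin fineK.
  + apply/measurable_EFinP.
    by apply: (@measurable_prod_tnth n.+1 (fun y => k (x, y))).
  + by move=> t _; rewrite lee_fin prodr_ge0.
  + by rewrite lee_fin.
Qed.

End iprod_integrals.

(** * Coordinatewise maps on powers of a measure *)

Section iprod_map.
Context {R : realType} {dT : measure_display} {T : measurableType dT}.
Variable m : {sigma_finite_measure set T -> \bar R}.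
Local Open Scope ereal_scope.
Local Notation "m ^%P n" := (@iprod _ _ _ m n) (at level 30).

Definition tmap n (f : 'I_n -> T -> T) (t : n.-tuple T) : n.-tuple T :=
  [tuple f i (tnth t i) | i < n].

Lemma tmap_tcons n (f : 'I_n.+1 -> T -> T) x t :
  tmap f (tcons (x, t)) = tcons (f ord0 x, tmap (fun i => f (lift ord0 i)) t).
Proof.
apply: eq_from_tnth => i; rewrite tnth_mktuple.
by case: (unliftP ord0 i) => [j|] ->; rewrite ?tconsS ?tcons0// tnth_mktuple.
Qed.

(** Induction on n by slicing: the slice over x of the preimage is the preimage of the slice of [A]
    over [f ord0 x], and each coordinate contributes one factor s. *)
Lemma iprod_tmap n (f : 'I_n -> T -> T) (s : {nonneg R}) :
  (forall i, measurable_fun setT (f i)) ->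
  (forall i A, measurable A -> m (f i @^-1` A) = s%:num%:E * m A) ->
  forall A, measurable A ->
  (m ^%P n) (tmap f @^-1` A) = (s%:num ^+ n)%:E * (m ^%P n) A.
Proof.
elim: n f => [|n IH] f mf ms A mA.
  rewrite expr0 mul1e; congr ((m ^%P 0) _); apply/seteqP.
  by split => t /=; rewrite (tuple0 (tmap f t)) (tuple0 t).
pose phi x := (m ^%P n) [set t | A (tcons (x, t))].
have mphi : measurable_fun setT phi.
  have mA' : measurable (@tcons T n @^-1` A).
    by rewrite -[X in measurable X]setTI; apply: measurable_tcons.
  have := measurable_fun_xsection (m ^%P n) mA'; congr measurable_fun.
  apply/funext => x /=; congr ((m ^%P n) _).
  by apply/seteqP; split => t /=; rewrite /xsection /= inE.
have phi0 x : 0 <= phi x by [].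
transitivity (\int[m]_x ((s%:num ^+ n)%:E * phi (f ord0 x))).
  apply: eq_integral => x _.
  rewrite /phi -(IH (fun i => f (lift ord0 i)))//.
  - by congr ((m ^%P n) _); apply/seteqP; split => t /=; rewrite -/(tcons (x, t)) tmap_tcons.
  - by move=> i B; exact: ms.
  - have mx : measurable_fun setT (fun t : n.-tuple T => tcons (f ord0 x, t)).
      by apply: measurableT_comp; [exact: measurable_tcons|exact: measurable_pair1].
    by rewrite -[X in measurable X]setTI; apply: mx.
rewrite ge0_integralZl//; last by apply: measurableT_comp.
rewrite -(ge0_integral_pushforward (mf ord0) m (D := setT) (f := phi))//.
rewrite (eq_measure_integral (mscale s m)); last first.
  by move=> B mB _; rewrite /= /pushforward /mscale/= ms.
by rewrite ge0_integral_mscale// muleA -EFinM -exprSr.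
Qed.

End iprod_map.

(** * Lebesgue measure on tuples *)

Lemma measurable_pred d (T : measurableType d) (f : T -> bool) :
  measurable_fun setT f -> measurable [set x | f x].
Proof. by move=> mf; rewrite -[X in measurable X]setTI; apply: mf. Qed.

Lemma natr_predE (R : pzRingType) (T : Type) (f : T -> bool) :
  (fun x => (f x)%:R : R) = \1_[set x | f x].
Proof.
apply/funext => x; rewrite indicE; have [fx|/negP fx] := boolP (f x).
- by rewrite mem_set.
- by rewrite memNset.
Qed.

Lemma measurable_natr_pred (R : realType) d (T : measurableType d) (f : T -> bool) :
  measurable_fun setT f -> measurable_fun setT (fun x => (f x)%:R : R).
Proof. by move=> /measurable_pred mf; rewrite natr_predE; exact: measurable_indic. Qed.

Lemma integral_natr_pred (R : realType) d (T : measurableType d)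
    (m : {measure set T -> \bar R}) (f : T -> bool) :
  measurable_fun setT f -> (\int[m]_x (f x)%:R%:E)%E = m [set x | f x].
Proof.
move=> /measurable_pred mf; rewrite -[X in m X]setIT -integral_indic//.
by apply: eq_integral => x _; rewrite -natr_predE.
Qed.

(** * Vector algebra and squared distances *)

Section linear_combination.
Context {R : realType} {d : nat}.
Implicit Types (x y z w : d.-tuple R) (a b r : R).

(** One operation covers sums, differences, translations and, with [b = 0], scalings, so that two
    expansion lemmas handle every dot product. *)
Definition lcomb a x b y : d.-tuple R :=
  [tuple a * tnth x k + b * tnth y k | k < d].

Lemma dotpC x y : dotp x y = dotp y x.
Proof. by apply: eq_bigr => k _; rewrite mulrC. Qed.

Lemma dotp_lcombl a x b y z : dotp (lcomb a x b y) z = a * dotp x z + b * dotp y z.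
Proof.
rewrite /dotp !mulr_sumr -big_split; apply: eq_bigr => k _ /=.
by rewrite tnth_mktuple mulrDl !mulrA.
Qed.

Lemma dotp_lcombr a x b y z : dotp z (lcomb a x b y) = a * dotp z x + b * dotp z y.
Proof. by rewrite dotpC dotp_lcombl !(dotpC z). Qed.

Lemma dotp_ge0 x : 0 <= dotp x x.
Proof. by apply: sumr_ge0 => k _; rewrite -expr2 sqr_ge0. Qed.

Lemma enorm_le1 x : (enorm x <= 1) = (dotp x x <= 1).
Proof. by rewrite /enorm -{1}(@sqrtr1 R) ler_sqrt. Qed.

Lemma enorm_eq1 x : (enorm x = 1) -> dotp x x = 1.
Proof. by move=> h; rewrite -(sqr_sqrtr (dotp_ge0 x)) -/(enorm x) h expr1n. Qed.

(** Squared Euclidean distance, expanded so that distance conditions become polynomial in dot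
    products. *)
Definition sqdist x y := dotp x x - 2 * dotp x y + dotp y y.

Lemma sqdist_lcomb x y : sqdist x y = dotp (lcomb 1 x (-1) y) (lcomb 1 x (-1) y).
Proof. rewrite dotp_lcombl !dotp_lcombr /sqdist (dotpC y x); ring. Qed.

Lemma edist_le x y r : 0 <= r -> (Defs.edist x y <= r) = (sqdist x y <= r ^+ 2).
Proof.
move=> r0; rewrite /Defs.edist (_ : \sum_(k < d) _ = sqdist x y).
  by rewrite -[in LHS](ger0_norm r0) -sqrtr_sqr ler_sqrt// sqr_ge0.
rewrite sqdist_lcomb; apply: eq_bigr => k _.
by rewrite tnth_mktuple expr2; ring.
Qed.

Lemma measurable_dotp dT (T : measurableType dT) (f g : T -> d.-tuple R) :
  measurable_fun setT f -> measurable_fun setT g ->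
  measurable_fun setT (fun t => dotp (f t) (g t)).
Proof.
move=> /measurable_fun_tnthP mf /measurable_fun_tnthP mg.
apply: measurable_sum => k; apply: measurable_funM.
- exact: mf.
- exact: mg.
Qed.

Lemma measurable_sqdist dT (T : measurableType dT) (f g : T -> d.-tuple R) :
  measurable_fun setT f -> measurable_fun setT g ->
  measurable_fun setT (fun t => sqdist (f t) (g t)).
Proof.
move=> mf mg; apply: measurable_funD; last exact: measurable_dotp.
apply: measurable_funB; first exact: measurable_dotp.
by apply: measurable_funM => //; exact: measurable_dotp.
Qed.

Lemma measurable_lcomb dT (T : measurableType dT) (f g : T -> d.-tuple R)
    (a b : T -> R) :
  measurable_fun setT f -> measurable_fun setT g ->
  measurable_fun setT a -> measurable_fun setT b ->
  measurable_fun setT (fun t => lcomb (a t) (f t) (b t) (g t)).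
Proof.
move=> /measurable_fun_tnthP mf /measurable_fun_tnthP mg ma mb.
apply/measurable_fun_tnthP => k.
rewrite (_ : _ \o _ = fun t => a t * tnth (f t) k + b t * tnth (g t) k); last first.
  by apply/funext => t /=; rewrite tnth_mktuple.
apply: measurable_funD; apply: measurable_funM => //.
- exact: mf.
- exact: mg.
Qed.

End linear_combination.

(** * Lebesgue measure under dilations and translations *)

Section lebesgue_d_measure.
Context {R : realType} {d : nat}.
Local Open Scope ereal_scope.
Local Notation lam1 :=
  (@lebesgue_measure R : {sigma_finite_measure set (measurableTypeR R) -> \bar R}).
Local Notation lam := (@lebesgue_d R d).
Local Notation Rd := (d.-tuple R).

(** [prob_consensus] measures tuples over [R] with its default display, whereas
[lebesgue_d] is defined over [measurableTypeR R]; the two sigma-algebras are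
convertible, but the structures have to be declared anew. *)
Let lam0 : lam set0 = 0.
Proof. exact: (measure0 (@iprod _ _ _ lam1 d)). Qed.

Let lam_ge0 A : 0 <= lam A.
Proof. exact: (measure_ge0 (@iprod _ _ _ lam1 d)). Qed.

Let lam_sigma_additive : semi_sigma_additive (T := Rd) lam.
Proof. exact: (@measure_semi_sigma_additive _ _ _ (@iprod _ _ _ lam1 d)). Qed.

HB.instance Definition _ :=
  @isMeasure.Build _ Rd _ lam lam0 lam_ge0 lam_sigma_additive.

Let lam_sigma_finite : sigma_finite (T := Rd) setT lam.
Proof. exact: (sigma_finiteT (@iprod _ _ _ lam1 d)). Qed.

HB.instance Definition _ :=
  @Measure_isSigmaFinite.Build _ Rd _ lam lam_sigma_finite.

(** The pushforward scaled by [s^-1] agrees with Lebesgue measure on half-open intervals, hence on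
    all measurable sets by uniqueness. *)
Lemma lebesgue_measure_affine (s z : R) (A : set (measurableTypeR R)) : (0 < s)%R ->
  measurable A ->
  @lebesgue_measure R ((fun x => (s^-1 * (x - z))%R : measurableTypeR R) @^-1` A) = s%:E * lebesgue_measure A.
Proof.
move=> s0 mA.
pose f (x : measurableTypeR R) : measurableTypeR R := (s^-1 * (x - z))%R.
have mf : measurable_fun setT f.
  by apply: (@measurable_funM _ R R setT (cst s^-1%R) (fun x => x - z)%R) => //;
    exact: measurable_funB.
have si0 : (0 <= s^-1)%R by rewrite invr_ge0 ltW.
pose mu := mscale (NngNum si0)
  [the {measure set _ -> \bar R} of pushforward (@lebesgue_measure R) f].
have -> : @lebesgue_measure R A = mu mf A.
  apply: lebesgue_measure_unique => //= _ [[a b]] _ <-.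
  rewrite /mu /mscale /= /pushforward.
  have -> : f @^-1` `]a, b]%classic = `](s * a + z)%R, (s * b + z)%R]%classic.
    apply: eq_set => x /=; rewrite !in_itv /= /f [(s^-1 * _)%R]mulrC.
    by rewrite ltr_pdivlMr// ler_pdivrMr// ltrBrDr lerBlDr ![(_ * s)%R]mulrC.
  rewrite !lebesgue_measure_itv /= !lte_fin ltrD2r ltr_pM2l//.
  case: ifP => _; rewrite ?mule0// -!EFinB -EFinM; congr EFin.
  by field; rewrite gt_eqF.
rewrite /mu /mscale /= muleA -EFinM mulfV ?gt_eqF// mul1e.
by [].
Qed.

(** The set on the left is [z + s A]. The map acts coordinatewise, so the one-dimensional case lifts
    by [iprod_tmap]. *)
Lemma lebesgue_d_affine (s : R) (z : Rd) (A : set Rd) : (0 < s)%R ->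
  measurable A ->
  lam [set y | A (lcomb s^-1 y (- s^-1) z)] = (s ^+ d)%:E * lam A.
Proof.
move=> s0 mA.
have := @iprod_tmap R _ _ lam1 d (fun i x => s^-1 * (x - tnth z i))%R (NngNum (ltW s0)) _ _ A mA.
move=> <-.
- congr (lam _); apply/seteqP; split => y /=.
    by congr (A _); apply: eq_from_tnth => k; rewrite !tnth_mktuple mulrBr mulNr.
  by congr (A _); apply: eq_from_tnth => k; rewrite !tnth_mktuple mulrBr mulNr.
- move=> i.
  by apply: (@measurable_funM _ R R setT (cst s^-1%R) (fun x => x - tnth z i)%R) => //;
    exact: measurable_funB.
- by move=> i B mB; exact: lebesgue_measure_affine.
Qed.

Lemma lebesgue_d_transl (v : Rd) (A : set Rd) : measurable A ->
  lam [set y | A (lcomb 1 y 1 v)] = lam A.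
Proof.
move=> mA.
have := lebesgue_d_affine (lcomb (-1) v 0 v) (@ltr01 R) mA.
rewrite expr1n mul1e => <-; congr (lam _); apply: eq_set => y; congr (A _).
by apply: eq_from_tnth => k; rewrite !tnth_mktuple invr1; ring.
Qed.

End lebesgue_d_measure.

Section sections.
Local Open Scope ereal_scope.
(** Cavalieri's principle: both sides are the product measure of the region [E]. *)
Lemma integral_sections {R : realType} {d1 d2} {T1 : measurableType d1}
    {T2 : measurableType d2} (m1 : {sigma_finite_measure set T1 -> \bar R})
    (m2 : {sigma_finite_measure set T2 -> \bar R}) (E : T1 -> T2 -> bool) :
  measurable_fun [set: T1 * T2] (fun p => E p.1 p.2) ->
  \int[m1]_x m2 [set y | E x y] = \int[m2]_y m1 [set x | E x y].
Proof.
move=> /measurable_pred mE; have := indic_fubini_tonelli m1 m2 mE.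
rewrite indic_fubini_tonelli_FE// indic_fubini_tonelli_GE// => H.
transitivity (\int[m1]_x (m2 \o xsection [set p | E p.1 p.2]) x).
  apply: eq_integral => x _ /=; congr (m2 _).
  by apply/seteqP; split => y; rewrite /xsection /= inE.
rewrite H; apply: eq_integral => x _ /=; congr (m1 _).
by apply/seteqP; split => y; rewrite /ysection /= inE.
Qed.
End sections.

(** * Invariance under reflections, and nullity of hyperplanes *)

Section isometry.
Context {R : realType} {d : nat}.
Local Notation lam := (@lebesgue_d R d).
Local Notation Rd := (d.-tuple R).
Local Open Scope ereal_scope.

(** Computes the volume of [{(x, y) | A (L x) /\ B (y + L x)}] by slicing in x, and
by slicing in y after translating x by [- L y]. With [L = id] this also gives
the invariance under [x |-> - x]. *)
Lemma lebesgue_d_linear_preim (L : Rd -> Rd) (A B : Rd -> bool) :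
  measurable_fun setT L -> measurable_fun setT A -> measurable_fun setT B ->
  (forall x y, L (lcomb 1 x (-1) (L y)) = lcomb 1 (L x) (-1) y) ->
  (forall x, B (L x) = B x) ->
  0 < lam [set x | B x] -> lam [set x | B x] < +oo ->
  lam [set x | A (L x)] = lam [set x | A (lcomb (-1) x 0 x)].
Proof.
move=> mL mA mB hL BL B0 Boo.
have mAL : measurable_fun setT (A \o L) by exact: measurableT_comp.
have mfst : measurable_fun [set: Rd * Rd] fst by [].
have msnd : measurable_fun [set: Rd * Rd] snd by [].
have mLfst := measurableT_comp mL mfst.
pose E x y := A (L x) && B (lcomb 1 y 1 (L x)).
have mE : measurable_fun [set: Rd * Rd] (fun p => E p.1 p.2).
  apply: measurable_and; first exact: (measurableT_comp mA mLfst).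
  by apply: (measurableT_comp mB); exact: measurable_lcomb.
pose G y x := A (lcomb 1 (L x) (-1) y) && B (L x).
have mG : measurable_fun [set: Rd * Rd] (fun p => G p.1 p.2).
  have mLsnd := measurableT_comp mL msnd.
  apply: measurable_and; last exact: (measurableT_comp mB mLsnd).
  by apply: (measurableT_comp mA); exact: measurable_lcomb.
have bool_section (P : bool) (S : set Rd) :
    lam [set y | P /\ S y] = (P%:R)%:E * lam S.
  case: P; rewrite /= ?mul1e ?mul0e.
    by congr (lam _); apply/seteqP; split => y // -[].
  by rewrite (_ : [set y | _] = set0) ?measure0//; apply/seteqP; split => y // -[].
have mpB := measurable_pred mB.
have H := integral_sections lam lam mE.
have HG := integral_sections lam lam mG.
(* Translating x by [- L y] turns [L x] into [L x - y] inside [A], and [y + L x] into [L x] inside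
   [B]. *)
have EG : \int[lam]_y lam [set x | E x y] = \int[lam]_y lam [set x | G y x].
  apply: eq_integral => y _.
  rewrite -(@lebesgue_d_transl _ _ (lcomb (-1) (L y) 0 y) [set x | E x y]); last first.
    apply: measurable_pred.
    have mp : measurable_fun setT (fun x : Rd => (x, y)) by exact: measurable_pair2.
    exact: (measurableT_comp mE mp).
  congr (lam _); apply: eq_set => x; rewrite /E /G /=.
  have -> : L (lcomb 1 x 1 (lcomb (-1) (L y) 0 y)) = lcomb 1 (L x) (-1) y.
    by rewrite -hL; congr L; apply: eq_from_tnth => k; rewrite !tnth_mktuple; ring.
  by congr (_ && B _); apply: eq_from_tnth => k; rewrite !tnth_mktuple; ring.
have lhs : \int[lam]_x lam [set y | E x y] =
    lam [set x | A (L x)] * lam [set x | B x].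
  transitivity (\int[lam]_x ((A (L x))%:R%:E * lam [set x | B x])).
    apply: eq_integral => x _; rewrite -(lebesgue_d_transl (L x) mpB) -bool_section.
    by congr (lam _); apply: eq_set => y; apply/propext; rewrite /E; split => [/andP//|/= ?]; apply/andP.
  rewrite ge0_integralZr ?integral_natr_pred//.
  by apply/measurable_EFinP; exact: measurable_natr_pred.
have rhs : \int[lam]_x lam [set y | G y x] =
    lam [set x | B x] * lam [set x | A (lcomb (-1) x 0 x)].
  have mAN : measurable_fun setT (fun x : Rd => A (lcomb (-1) x 0 x)).
    by apply: (measurableT_comp mA); exact: measurable_lcomb.
  (* For fixed x, the set of y with [A (L x - y)] is a translate of the set of y with [A (- y)]. *)
  transitivity (\int[lam]_x ((B x)%:R%:E * lam [set x | A (lcomb (-1) x 0 x)])).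
    apply: eq_integral => x _.
    rewrite -(lebesgue_d_transl (lcomb (-1) (L x) 0 x) (measurable_pred mAN)) -bool_section.
    congr (lam _); apply: eq_set => y; apply/propext; rewrite /G BL /=.
    have -> : lcomb (-1) (lcomb 1 y 1 (lcomb (-1) (L x) 0 x)) 0
        (lcomb 1 y 1 (lcomb (-1) (L x) 0 x)) = lcomb 1 (L x) (-1) y.
      by apply: eq_from_tnth => k; rewrite !tnth_mktuple; ring.
    by split => [/andP[]//|[? ?]]; apply/andP.
  rewrite ge0_integralZr ?integral_natr_pred//.
  by apply/measurable_EFinP; exact: measurable_natr_pred.
have := lhs; rewrite H EG HG rhs muleC.
(* The common factor, the volume of [B], is finite and nonzero, hence cancels. *)
have Bfin : lam [set x | B x] \is a fin_num by rewrite ge0_fin_numE.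
rewrite -(fineK Bfin); set v := fine _ => eqv.
have v0 : (v != 0)%R by rewrite gt_eqF// -lte_fin fineK.
have mulK (t : \bar R) : t * v%:E * (v^-1)%:E = t by rewrite -muleA -EFinM mulfV// mule1.
by rewrite -[LHS]mulK -eqv mulK.
Qed.

Definition householder (w : Rd) (x : Rd) : Rd := lcomb 1 x (- 2 * dotp w x) w.

Lemma measurable_householder (w : Rd) : measurable_fun setT (householder w).
Proof.
apply: measurable_lcomb => //.
by apply: measurable_funM => //; exact: measurable_dotp.
Qed.

(** The reflection and the identity both satisfy [lebesgue_d_linear_preim] with [B] the unit ball,
    so both sides equal the volume of the set of x with [A (- x)]. *)
Lemma lebesgue_d_householder (w : Rd) (A : Rd -> bool) :
  dotp w w = 1%R -> measurable_fun setT A ->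
  0 < lam [set x | (dotp x x <= 1)%R] -> lam [set x | (dotp x x <= 1)%R] < +oo ->
  lam [set x | A (householder w x)] = lam [set x | A x].
Proof.
move=> w1 mA B0 Boo.
have mB : measurable_fun setT (fun x : Rd => (dotp x x <= 1)%R).
  by apply: measurable_fun_ler => //; exact: measurable_dotp.
rewrite (lebesgue_d_linear_preim (measurable_householder w) mA mB)//.
- rewrite -(@lebesgue_d_linear_preim id A _ _ mA mB)//.
- move=> x y; apply: eq_from_tnth => k; rewrite !tnth_mktuple !dotp_lcombr w1; ring.
- move=> x; congr (_ <= _)%R; rewrite dotp_lcombl !dotp_lcombr w1 (dotpC x w); ring.
Qed.

(** All hyperplanes [w . y = t] have the same volume by translation; by Fubini its
integral over the real line is that of the length of singletons. *)
Lemma lebesgue_d_hyperplane (w : Rd) (c : R) : dotp w w = 1%R ->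
  lam [set x | dotp w x == c] = 0.
Proof.
move=> w1.
have mw : measurable_fun setT (dotp w) by exact: measurable_dotp.
pose lam1 := (@lebesgue_measure R : {sigma_finite_measure set (measurableTypeR R) -> \bar R}).
pose E (t : measurableTypeR R) (y : Rd) := dotp w y == t.
have mE : measurable_fun [set: measurableTypeR R * Rd] (fun p => E p.1 p.2).
  apply: (@measurable_fun_eqr _ _ R setT (fun p : measurableTypeR R * Rd => dotp w p.2) (fun p => p.1 : R)).
    exact: (measurableT_comp mw).
  exact: measurable_fst.
have := integral_sections lam1 lam mE.
rewrite [RHS](_ : _ = 0); last first.
  rewrite integral0_eq// => y _; rewrite -(lebesgue_measure_set1 (dotp w y)).
  by congr (lebesgue_measure _); apply/seteqP; split => t /=; rewrite /E eq_sym => /eqP.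
rewrite (eq_integral (cst (lam [set x | dotp w x == c]))); last first.
  move=> t _ /=; rewrite -(@lebesgue_d_transl _ _ (lcomb (c - t) w 0 w) [set x | dotp w x == c]); last first.
    by apply: measurable_pred; apply: measurable_fun_eqr.
  congr (lam _); apply: eq_set => y; rewrite /E /= !dotp_lcombr w1.
  by congr is_true; apply/eqP/eqP; lra.
rewrite integral_cst//= => /eqP.
rewrite mule_eq0 => /orP[/eqP//|].
rewrite /lam1 -set_itvNyy lebesgue_measure_itv /=; by [].
Qed.

End isometry.

(** * Volumes of neighbourhoods *)

Section euclid.
Context {R : realType} {d : nat}.
Implicit Types (x y z w u p : d.-tuple R) (a b r s t : R).

(** Cauchy-Schwarz, from the nonnegative square of the component of u orthogonal to w. *)
Lemma dotp_unit_sq_le w u : dotp w w = 1 -> dotp w u ^+ 2 <= dotp u u.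
Proof.
move=> w1; have := dotp_ge0 (lcomb 1 u (- dotp w u) w).
rewrite dotp_lcombl !dotp_lcombr w1 (dotpC u w); nra.
Qed.

Lemma dotp_unit_le w u s : 0 <= s -> dotp w w = 1 -> dotp u u <= s ^+ 2 ->
  - s <= dotp w u <= s.
Proof.
move=> s0 w1 us; rewrite -ler_norml -[leRHS]ger0_norm// -ler_sqr ?nnegrE//.
by rewrite !real_normK ?num_real// (le_trans (dotp_unit_sq_le u w1)).
Qed.

(** Triangle inequality for squared norms: the square of [t p - s u] being nonnegative gives
    [p . u <= s t]. *)
Lemma dotp_add_le p u s t : 0 < s -> 0 < t -> dotp p p <= s ^+ 2 ->
  dotp u u <= t ^+ 2 -> dotp (lcomb 1 p 1 u) (lcomb 1 p 1 u) <= (s + t) ^+ 2.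
Proof.
move=> s0 t0 ps ut.
have := dotp_ge0 (lcomb t p (- s) u).
rewrite !dotp_lcombl !dotp_lcombr (dotpC u p) => h.
have st : 0 < s * t by exact: mulr_gt0.
have h1 : t ^+ 2 * dotp p p <= t ^+ 2 * s ^+ 2 by apply: ler_wpM2l => //; exact: sqr_ge0.
have h2 : s ^+ 2 * dotp u u <= s ^+ 2 * t ^+ 2 by apply: ler_wpM2l => //; exact: sqr_ge0.
have : dotp p u <= s * t.
  rewrite -(ler_pM2l st); lra.
lra.
Qed.

End euclid.

Lemma sqdistC {R : realType} {d : nat} (x y : d.-tuple R) : sqdist x y = sqdist y x.
Proof. by rewrite /sqdist dotpC; ring. Qed.

(** * Volumes of boxes and balls *)

Section ball_volume.
Context {R : realType} {d : nat}.
Local Notation lam := (@lebesgue_d R d).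
Local Notation Rd := (d.-tuple R).
Local Open Scope ereal_scope.

Lemma measurable_box (s : R) :
  measurable [set x : Rd | [forall k, (`|tnth x k| <= s)%R]].
Proof.
rewrite (_ : [set x : Rd | _] = \bigcap_(k in [set: 'I_d])
  [set x | (`|tnth x k| <= s)%R]).
  apply: fin_bigcap_measurable => // k _; apply: measurable_pred.
  apply: measurable_fun_ler => //.
  by apply: measurableT_comp => //; exact: measurable_tnth.
apply/seteqP; split => x /=; first by move/forallP => H k _; exact: H.
by move=> H; apply/forallP => k; exact: H.
Qed.

(** The indicator of the box is a product of one-dimensional indicators, so its integral is a
    power. *)
Lemma lebesgue_d_box (s : R) : (0 <= s)%R ->
  lam [set x | [forall k, (`|tnth x k| <= s)%R]] = ((s + s) ^+ d)%:E.
Proof.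
move=> s0.
pose lam1 := (@lebesgue_measure R : {sigma_finite_measure set (measurableTypeR R) -> \bar R}).
have itvE : [set x : R | (`|x| <= s)%R] = `[(- s)%R, s]%classic.
  by apply: eq_set => x; rewrite in_itv/= ler_norml.
have mI : @measurable _ (measurableTypeR R) [set x : R | (`|x| <= s)%R].
  by rewrite itvE; exact: (@measurable_itv R `[(- s)%R, s]).
pose h (x : measurableTypeR R) : R := (\1_[set x : R | (`|x| <= s)%R] x)%R.
have mh : measurable_fun setT h by exact: measurable_indic.
have Ih : \int[lam1]_x (h x)%:E = (s + s)%:E.
  rewrite integral_indic// setIT itvE /lam1 /= lebesgue_measure_itv/= lte_fin.
  rewrite -EFinB opprK; case: ifPn => // /negP; rewrite -subr_gt0 opprK => /negP.
  by rewrite -leNgt => ss; congr EFin; lra.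
have h0 x : (0 <= h x)%R by rewrite /h indicE.
rewrite -(integral_iprod_prod d mh h0 Ih).
have mbox : @measurable _ (d.-tuple (measurableTypeR R))
    [set x : d.-tuple R | [forall k, (`|tnth x k| <= s)%R]].
  exact: measurable_box.
transitivity (\int[@iprod _ _ _ lam1 d]_x
    (\1_[set x : d.-tuple R | [forall k, (`|tnth x k| <= s)%R]] x)%:E).
  by rewrite integral_indic// setIT.
apply: eq_integral => x _; congr EFin; rewrite -natr_predE.
case: (boolP [forall k, (`|tnth x k| <= s)%R]) => [/forallP H|/forallPn[k nk]].
  by rewrite big1// => k _; rewrite /h -natr_predE H.
by rewrite (bigD1 k)//= /h -natr_predE (negbTE nk) mul0r.
Qed.

Local Notation ball := [set x : Rd | (dotp x x <= 1)%R].

Lemma measurable_unit_ball : measurable ball.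
Proof.
by apply: measurable_pred; apply: measurable_fun_ler => //; exact: measurable_dotp.
Qed.

Lemma lebesgue_d_ball_fin : lam ball < +oo.
Proof.
apply: (@le_lt_trans _ _ (lam [set x | [forall k, (`|tnth x k| <= 1)%R]])).
  apply: le_measure; rewrite ?inE; [exact: measurable_unit_ball|exact: measurable_box|].
  move=> x /= xx; apply/forallP => k; rewrite -(@expr_le1 _ 2)// real_normK ?num_real//.
  by apply: le_trans xx; rewrite expr2 /dotp (bigD1 k)//= lerDl sumr_ge0// => j _; rewrite -expr2 sqr_ge0.
by rewrite lebesgue_d_box// ltry.
Qed.

Lemma lebesgue_d_ball_gt0 : (0 < d)%N -> 0 < lam ball.
Proof.
move=> d0; have dR : (0 < d%:R :> R)%R by rewrite ltr0n.
(* The cube of half-side [1 / d] lies in the ball: each of the d squares is at most [1 / d * 1]. *)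
apply: (@lt_le_trans _ _ (lam [set x | [forall k, (`|tnth x k| <= d%:R^-1)%R]])).
  rewrite lebesgue_d_box ?invr_ge0 ?ler0n// lte_fin exprn_gt0// addr_gt0 ?invr_gt0//.
apply: le_measure; rewrite ?inE; [exact: measurable_box|exact: measurable_unit_ball|].
move=> x /= /forallP xk.
apply: (@le_trans _ _ (\sum_(k < d) d%:R^-1 * 1)%R); last first.
  by rewrite mulr1 sumr_const card_ord -(mulr_natr d%:R^-1) mulVf ?gt_eqF.
apply: ler_sum => k _; rewrite -expr2 -real_normK ?num_real// expr2.
apply: ler_pM => //; apply: le_trans (xk k) _.
by rewrite invf_le1 ?ler1n.
Qed.

Lemma lebesgue_d_sqdist_ball (z : Rd) (s : R) : (0 < s)%R ->
  lam [set y | (sqdist y z <= s ^+ 2)%R] = (s ^+ d)%:E * lam ball.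
Proof.
move=> s0; rewrite -(lebesgue_d_affine z s0 measurable_unit_ball); congr (lam _).
apply: eq_set => y; congr is_true.
rewrite !dotp_lcombl !dotp_lcombr (dotpC z y).
have -> : (s^-1 * (s^-1 * dotp y y + - s^-1 * dotp y z) +
  - s^-1 * (s^-1 * dotp y z + - s^-1 * dotp z z) = (s ^+ 2)^-1 * sqdist y z)%R.
  by rewrite /sqdist; field; rewrite gt_eqF.
by rewrite ler_pdivrMl ?exprn_gt0// mulr1.
Qed.

End ball_volume.

(** * The parts of a neighbourhood in the unit ball *)

Section neighbourhood.
Context {R : realType} {d : nat}.
Local Notation lam := (@lebesgue_d R d).
Local Notation Rd := (d.-tuple R).
Variables (r : R) (w : Rd).
Local Notation ball := [set x : Rd | dotp x x <= 1].

Definition nbr (x y : Rd) := (dotp y y <= 1) && (sqdist x y <= r ^+ 2).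
Definition above (x y : Rd) := dotp w x < dotp w y.
(** [nbrU], [nbrP] and [nbrN] are the parts U, P and Q of the overview. *)
Definition nbrU x y := nbr x y && above x y.
Definition nbrP x y := nbr x y && (~~ above x y && (0 <= dotp w y)).
Definition nbrN x y := nbr x y && (~~ above x y && ~~ (0 <= dotp w y)).

Lemma measurable_nbr dT (T : measurableType dT) (f g : T -> Rd) :
  measurable_fun setT f -> measurable_fun setT g ->
  measurable_fun setT (fun t => nbr (f t) (g t)).
Proof.
move=> mf mg; apply: measurable_and; apply: measurable_fun_ler => //.
- exact: measurable_dotp.
- exact: measurable_sqdist.
Qed.

Lemma measurable_above dT (T : measurableType dT) (f g : T -> Rd) :
  measurable_fun setT f -> measurable_fun setT g ->
  measurable_fun setT (fun t => above (f t) (g t)).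
Proof. by move=> mf mg; apply: measurable_fun_ltr; exact: measurable_dotp. Qed.

Lemma measurable_halfspace dT (T : measurableType dT) (f : T -> Rd) :
  measurable_fun setT f -> measurable_fun setT (fun t => 0 <= dotp w (f t)).
Proof. by move=> mf; apply: measurable_fun_ler => //; exact: measurable_dotp. Qed.

Lemma sqdist_triangle (x y z : Rd) (s t : R) : 0 < s -> 0 < t ->
  sqdist x z <= s ^+ 2 -> sqdist y z <= t ^+ 2 -> sqdist x y <= (s + t) ^+ 2.
Proof.
move=> s0 t0 xz yz.
have := @dotp_add_le R d (lcomb 1 x (-1) z) (lcomb 1 z (-1) y) s t s0 t0.
rewrite -!sqdist_lcomb (sqdistC z).
move=> /(_ xz yz); congr (_ <= _).
rewrite sqdist_lcomb; congr dotp; apply: eq_from_tnth => k; rewrite !tnth_mktuple; ring.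
Qed.

Lemma sqdist_ball (x z : Rd) (s t : R) : 0 < s -> 0 < t ->
  dotp z z <= s ^+ 2 -> sqdist x z <= t ^+ 2 -> dotp x x <= (s + t) ^+ 2.
Proof.
move=> s0 t0 zs xz.
have := @dotp_add_le R d z (lcomb 1 x (-1) z) s t s0 t0 zs.
rewrite -!sqdist_lcomb => /(_ xz); congr (_ <= _).
congr dotp; apply: eq_from_tnth => k; rewrite !tnth_mktuple; ring.
Qed.

Lemma nbrU_ge (x : Rd) : 0 < r -> r <= 1 / 2 -> dotp w w = 1 ->
  dotp x x <= 1 -> dotp w x <= 1 / 2 ->
  (((r / 32) ^+ d)%:E * lam ball <= lam [set y | nbrU x y])%E.
Proof.
move=> r0 r2 w1 xx wx; have rho0 : 0 < r / 32 by lra.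
have /andP[wx1 _] : - 1 <= dotp w x <= 1.
  by apply: dotp_unit_le => //; rewrite expr1n.
(* Shrinking x by [1 - r / 2] makes room inside the unit ball and lowers the height by at most
   [r / 4], as [w . x <= 1 / 2]; the shift [5 * r / 16] along w leaves z at least [r / 16] above x,
   more than the radius [r / 32]. *)
pose z := lcomb (1 - r / 2) x (5 * r / 16) w.
rewrite -(lebesgue_d_sqdist_ball z rho0).
have mid : measurable_fun [set: Rd] id by [].
have mc (v : Rd) : measurable_fun [set: Rd] (fun=> v) by [].
apply: le_measure; rewrite ?inE.
- by apply: measurable_pred; apply: measurable_fun_ler => //; exact: measurable_sqdist.
- by apply: measurable_pred; apply: measurable_and; [exact: measurable_nbr|exact: measurable_above].
move=> y /= yz.
have zz : dotp z z <= (1 - r / 32) ^+ 2.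
  rewrite !dotp_lcombl !dotp_lcombr w1 (dotpC x w).
  move: (dotp x x) (dotp w x) xx wx wx1 => X H X1 H2 H1.
  have -> : (1 - r / 2) * ((1 - r / 2) * X + 5 * r / 16 * H) +
     5 * r / 16 * ((1 - r / 2) * H + 5 * r / 16 * 1) =
     (1 - r / 2) ^+ 2 * X + 2 * (1 - r / 2) * (5 * r / 16) * H + (5 * r / 16) ^+ 2.
    by field.
  have : (1 - r / 2) ^+ 2 * X <= (1 - r / 2) ^+ 2 * 1 by apply: ler_wpM2l => //; exact: sqr_ge0.
  have : 2 * (1 - r / 2) * (5 * r / 16) * H <= 2 * (1 - r / 2) * (5 * r / 16) * (1 / 2).
    by apply: ler_wpM2l => //; rewrite !mulr_ge0//; lra.
  nra.
have xz : sqdist x z <= (r - r / 32) ^+ 2.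
  rewrite sqdist_lcomb /z !(dotp_lcombl, dotp_lcombr) w1 (dotpC x w).
  move: (dotp x x) (dotp w x) xx wx wx1 => X H X1 H2 H1.
  match goal with |- is_true (?e <= _) => have -> : e =
     (r / 2) ^+ 2 * X - 2 * (r / 2) * (5 * r / 16) * H + (5 * r / 16) ^+ 2 by field end.
  have : (r / 2) ^+ 2 * X <= (r / 2) ^+ 2 * 1 by apply: ler_wpM2l => //; exact: sqr_ge0.
  have : 2 * (r / 2) * (5 * r / 16) * - H <= 2 * (r / 2) * (5 * r / 16) * 1.
    by apply: ler_wpM2l => //; [rewrite !mulr_ge0//; lra|lra].
  nra.
rewrite /nbrU /nbr; apply/andP; split; [apply/andP; split|].
- have := @sqdist_ball y z (1 - r / 32) (r / 32) _ rho0 zz yz.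
  by rewrite subrK expr1n; apply; lra.
- have := @sqdist_triangle x y z (r - r / 32) (r / 32) _ rho0 xz yz.
  by rewrite subrK; apply; lra.
rewrite /above.
have /andP[+ _] : - (r / 32) <= dotp w (lcomb 1 y (-1) z) <= r / 32.
  by apply: dotp_unit_le => //; [exact: ltW|rewrite -sqdist_lcomb].
rewrite !dotp_lcombr w1; move: (dotp w x) (dotp w y) wx wx1 => H Y H2 H1.
nra.
Qed.

(** Same argument with z only pulled towards the origin; it serves the points with [w . x > 1 / 2],
    where U may be too small. *)
Lemma nbr_ge (x : Rd) : 0 < r -> r <= 1 / 2 -> dotp x x <= 1 ->
  (((r / 32) ^+ d)%:E * lam ball <= lam [set y | nbr x y])%E.
Proof.
move=> r0 r2 xx; have rho0 : 0 < r / 32 by lra.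
pose z := lcomb (1 - r / 2) x 0 x.
rewrite -(lebesgue_d_sqdist_ball z rho0).
have mid : measurable_fun [set: Rd] id by [].
have mc (v : Rd) : measurable_fun [set: Rd] (fun=> v) by [].
apply: le_measure; rewrite ?inE.
- by apply: measurable_pred; apply: measurable_fun_ler => //; exact: measurable_sqdist.
- by apply: measurable_pred; exact: measurable_nbr.
move=> y /= yz.
have zz : dotp z z <= (1 - r / 32) ^+ 2.
  rewrite !dotp_lcombl !dotp_lcombr !mul0r !addr0.
  have : (1 - r / 2) * ((1 - r / 2) * dotp x x) <= (1 - r / 2) * ((1 - r / 2) * 1).
    by apply: ler_wpM2l; [lra|apply: ler_wpM2l; [lra|]].
  nra.
have xz : sqdist x z <= (r - r / 32) ^+ 2.
  rewrite sqdist_lcomb /z !(dotp_lcombl, dotp_lcombr).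
  have : (r / 2) ^+ 2 * dotp x x <= (r / 2) ^+ 2 * 1 by apply: ler_wpM2l => //; exact: sqr_ge0.
  nra.
apply/andP; split.
- have := @sqdist_ball y z (1 - r / 32) (r / 32) _ rho0 zz yz.
  by rewrite subrK expr1n; apply; lra.
- have := @sqdist_triangle x y z (r - r / 32) (r / 32) _ rho0 xz yz.
  by rewrite subrK; apply; lra.
Qed.

Lemma nbr_le (x : Rd) : 0 < r ->
  (lam [set y | nbr x y] <= (r ^+ d)%:E * lam ball)%E.
Proof.
move=> r0; rewrite -(lebesgue_d_sqdist_ball x r0).
have mid : measurable_fun [set: Rd] id by [].
have mc (v : Rd) : measurable_fun [set: Rd] (fun=> v) by [].
apply: le_measure; rewrite ?inE.
- by apply: measurable_pred; exact: measurable_nbr.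
- by apply: measurable_pred; apply: measurable_fun_ler => //; exact: measurable_sqdist.
by move=> y /= /andP[_]; rewrite sqdistC.
Qed.

Lemma nbrN_empty (x : Rd) : 0 < r -> r <= 1 / 2 -> dotp w w = 1 ->
  1 / 2 < dotp w x -> [set y | nbrN x y] = set0.
Proof.
move=> r0 r2 w1 wx; apply/seteqP; split => y //= /andP[/andP[_ xy] /andP[_]]; rewrite -ltNge => wy.
have /andP[_] : - r <= dotp w (lcomb 1 x (-1) y) <= r.
  by apply: dotp_unit_le => //; [exact: ltW|rewrite -sqdist_lcomb].
by rewrite dotp_lcombr; lra.
Qed.

Lemma nbrN_le (x : Rd) : dotp w w = 1 -> (0 < d)%N ->
  (lam [set y | nbrN x y] <= lam [set y | nbrU x y] + lam [set y | nbrP x y])%E.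
Proof.
move=> w1 d0; have mid : measurable_fun [set: Rd] id by [].
have mc (v : Rd) : measurable_fun [set: Rd] (fun=> v) by [].
have mU : measurable [set y | nbrU x y].
  by apply: measurable_pred; apply: measurable_and; [exact: measurable_nbr|exact: measurable_above].
have mnA : measurable_fun [set: Rd] (fun y => ~~ above x y).
  by apply: measurable_neg; exact: measurable_above.
have mH : measurable_fun [set: Rd] (fun y => 0 <= dotp w y).
  exact: measurable_halfspace.
have mP : measurable [set y | nbrP x y].
  apply: measurable_pred; apply: measurable_and; first exact: measurable_nbr.
  exact: measurable_and.
have mN : measurable [set y | nbrN x y].
  apply: measurable_pred; apply: measurable_and; first exact: measurable_nbr.
  by apply: measurable_and => //; exact: measurable_neg.
(* m is the level of the mirror: [tr] after [householder w] is the reflection in [w . y = m]. *)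
pose m := Num.min (dotp w x) 0.
pose tr y := lcomb 1 y 1 (lcomb (2 * m) w 0 w).
(* The third alternative is a null set: it catches the points of Q at the height of x, which the
   mirror fixes when [m = w . x]. *)
pose A y := [|| nbrU x y, nbrP x y | dotp w y == dotp w x].
have mA : measurable_fun [set: Rd] A.
  apply: measurable_or; last apply: measurable_or.
  - by apply: measurable_and; [exact: measurable_nbr|exact: measurable_above].
  - by apply: measurable_and; [exact: measurable_nbr|exact: measurable_and].
  - by apply: measurable_fun_eqr => //; exact: measurable_dotp.
have mAtr : measurable_fun [set: Rd] (A \o tr).
  by apply: measurableT_comp => //; exact: measurable_lcomb.
have E : lam [set y | (A \o tr) (householder w y)] = lam [set y | A y].
  rewrite (lebesgue_d_householder w1 mAtr (lebesgue_d_ball_gt0 d0) lebesgue_d_ball_fin).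
  exact: (lebesgue_d_transl _ (measurable_pred mA)).
apply: (@le_trans _ _ (lam [set y | A y])); last first.
  have -> : [set y | A y] = [set y | nbrU x y] `|` ([set y | nbrP x y] `|` [set y | dotp w y == dotp w x]).
    apply/seteqP; split => y /=; rewrite /A.
      by case/or3P=> h; [left|right; left|right; right].
    by move=> [h|[h|h]]; apply/or3P; [exact: Or31|exact: Or32|exact: Or33].
  have mE : measurable [set y : Rd | dotp w y == dotp w x].
    by apply: measurable_pred; apply: measurable_fun_eqr => //; exact: measurable_dotp.
  apply: le_trans (measureU2 _ mU (measurableU _ _ mP mE)) _.
  apply: leeD => //; apply: le_trans (measureU2 _ mP mE) _.
  by rewrite [X in (_ + X)%E](lebesgue_d_hyperplane _ w1) adde0.
rewrite -E; apply: le_measure; rewrite ?inE//.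
  apply: measurable_pred; apply: (measurableT_comp mAtr); exact: measurable_householder.
move=> y /= /andP[/andP[yy xy] /andP[]]; rewrite /above -leNgt -ltNge => yx y0.
have ym : dotp w y <= m by rewrite le_min yx ltW.
have m0 : m <= 0 by rewrite ge_min lexx orbT.
have mx : m <= dotp w x by rewrite ge_min lexx.
set y' := tr (householder w y).
have wy' : dotp w y' = 2 * m - dotp w y.
  by rewrite /y' /tr /householder !dotp_lcombr w1; ring.
have yy' : dotp y' y' = dotp y y + 4 * (m - dotp w y) * m.
  rewrite /y' /tr /householder !(dotp_lcombl, dotp_lcombr) w1 (dotpC y w); ring.
have xy' : dotp x y' = dotp x y + 2 * (m - dotp w y) * dotp w x.
  rewrite /y' /tr /householder !dotp_lcombr (dotpC x w); ring.
have nb : nbr x y'.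
  (* The origin and x both satisfy [w . _ >= m], while y lies on the other side; so reflecting y
     does not increase its distance to either. *)
  have p1 : 0 <= (m - dotp w y) * - m by rewrite mulr_ge0//; lra.
  have p2 : 0 <= (m - dotp w y) * (dotp w x - m) by rewrite mulr_ge0//; lra.
  by move: xy; rewrite /nbr /sqdist yy' xy' => xy; apply/andP; split; lra.
rewrite /A /nbrU /nbrP nb /= /above wy'.
(* If [w . x > 0], the mirror is at 0 and the image has positive height, hence is in U or P.
   Otherwise the mirror is at x and the image is above x or level with it. *)
have [h|h] := ltP 0 (dotp w x).
  have -> : m = 0 by apply/min_idPr/ltW.
  case: ltP => //= _; apply/orP; left; lra.
have -> : m = dotp w x by apply/min_idPl.
case: ltgtP => //=; rewrite ?orbT//.
have : dotp w y <= dotp w x by [].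
lra.
Qed.

End neighbourhood.

(** * Numerical estimates *)

Section numeric.
Context {R : realType}.
Implicit Types l : R.

(** With [E = expR l], the left side is [(E - 1) ^ 2 / E], and [E (1 - l) <= 1] gives
    [E - 1 <= 4 l / 3]. *)
Lemma expR_cosh_le l : 0 <= l -> l <= 1 / 4 -> expR l + expR (- l) - 2 <= 2 * l ^+ 2.
Proof.
move=> l0 l4; rewrite expRN; set E := expR l.
have E1 : 1 + l <= E by exact: expR_ge1Dx.
have E0 : 0 < E by exact: expR_gt0.
have E2 : E * (1 - l) <= 1.
  have := expR_ge1Dx (- l); rewrite expRN -/E => h.
  have : E * (1 - l) <= E * E^-1 by apply: ler_wpM2l; [exact: ltW|exact: h].
  by rewrite mulfV ?gt_eqF.
have -> : E + E^-1 - 2 = (E - 1) ^+ 2 / E by field; rewrite gt_eqF.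
rewrite ler_pdivrMr//.
have h : (E - 1) * 3 <= 4 * l by nra.
have : (E - 1) ^+ 2 * 9 <= 16 * l ^+ 2 by nra.
have : l ^+ 2 <= l ^+ 2 * E by rewrite ler_peMr ?sqr_ge0//; lra.
have := sqr_ge0 l; lra.
Qed.

Lemma expR_sinh_ge l : 0 <= l -> l <= 1 / 4 -> l <= expR l - expR (- l).
Proof.
move=> l0 l4.
have h1 := expR_ge1Dx l.
have : expR (- l) <= expR 0 by rewrite ler_expR; lra.
by rewrite expR0; lra.
Qed.

(** u, p, n stand for the volumes of U, P, Q, and a, b, c for [E exp (- l Z) - 1] on them. With x =
    2 cosh l - 2 and y = 2 sinh l, the choice of l makes the second-order cost [2 l ^ 2 W] half of
    the first-order gain [phi l K W]. *)
Lemma weighted_gain (u p n W K phi eta : R) (l := phi * K / 4)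
   (a := expR (- l) - 1)
   (b := (1 - eta) * expR (- l) + eta * expR l - 1)
   (c := eta * expR (- l) + (1 - eta) * expR l - 1) :
  0 <= u -> 0 <= p -> 0 <= n -> u + p + n <= W ->
  0 < K -> K <= 1 -> 0 < phi -> phi <= eta -> phi <= 1 / 2 - eta ->
  (K * W <= u /\ n <= u + p) \/ (n = 0 /\ K * W <= u + p) ->
  u * a + p * b + n * c <= - (phi ^+ 2 * K ^+ 2 / 8 * W).
Proof.
move=> u0 p0 n0 upn K0 K1 phi0 phe phh H.
have l0 : 0 <= l by rewrite /l; nra.
have l4 : l <= 1 / 4 by rewrite /l; nra.
have lphi : l <= phi / 4 by rewrite /l; nra.
have C := expR_cosh_le l0 l4; have S := expR_sinh_ge l0 l4.
set E := expR l in C S *; set F := expR (- l) in C S *.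
have W0 : 0 <= W by lra.
have KW0 : 0 <= K * W by rewrite mulr_ge0// ltW.
set x := E + F - 2 in C; set y := E - F in S.
have Ex : E = 1 + x / 2 + y / 2 by rewrite /x /y; lra.
have Fx : F = 1 + x / 2 - y / 2 by rewrite /x /y; lra.
have y0 : 0 <= y by lra.
have x0 : 0 <= x.
  rewrite /x (_ : E + F - 2 = (E - 1) ^+ 2 * F); first by rewrite mulr_ge0// ?sqr_ge0// expR_ge0.
  have : E * F = 1 by rewrite /E /F expRN mulfV// gt_eqF// expR_gt0.
  by move=> EF; rewrite expr2; transitivity (E * (E * F) - 2 * (E * F) + F); [rewrite EF|]; ring.
have bE : b = x / 2 - (1 / 2 - eta) * y by rewrite /b -/E -/F Ex Fx; lra.
have cE : c = x / 2 + (1 / 2 - eta) * y by rewrite /c -/E -/F Ex Fx; lra.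
have aE : a = x / 2 - y / 2 by rewrite /a -/F Fx; lra.
have gainE : phi ^+ 2 * K ^+ 2 / 8 * W = phi * l * (K * W) / 2 by rewrite /l; field.
rewrite gainE.
have lW : 2 * l * l * W = phi * l * (K * W) / 2 by rewrite /l; field.
have phil0 : 0 <= phi * l by rewrite mulr_ge0// ltW.
case: H => [[KWu nup]|[n00 KWup]].
- have c0 : 0 <= c by rewrite cE addr_ge0// ?mulr_ge0//; lra.
  have h1 : n * c <= (u + p) * c by apply: ler_wpM2r.
  (* The terms in y cancel between P and Q; on U a surplus [eta * y] remains, since a vote from U is
     + whatever the noise. *)
  have h2 : u * a + p * b + (u + p) * c = (u + p) * x - u * (eta * y).
    by rewrite aE bE cE; field.
  have h3 : (u + p) * x <= W * (2 * l ^+ 2).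
    by apply: ler_pM => //; [exact: addr_ge0|lra].
  have h4 : phi * l * (K * W) <= u * (eta * y).
    rewrite mulrC; apply: ler_pM => //; apply: ler_pM => //; exact: ltW.
  have h5 : W * (2 * l ^+ 2) = phi * l * (K * W) / 2 by rewrite -lW; ring.
  lra.
- have ab : a <= b.
    have : (1 / 2 - eta) * y <= 1 / 2 * y by apply: ler_wpM2r => //; lra.
    by rewrite aE bE; lra.
  have h1 : u * a <= u * b by apply: ler_wpM2l.
  have h2 : phi * l <= (1 / 2 - eta) * y by apply: ler_pM => //; exact: ltW.
  have h3 : l ^+ 2 <= phi * l / 4.
    by rewrite expr2 (_ : phi * l / 4 = phi / 4 * l); [exact: (ler_wpM2r l0 lphi)|field].
  have h4 : b <= - (phi * l * 3 / 4) by rewrite bE; lra.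
  have h5 : (u + p) * b <= (u + p) * - (phi * l * 3 / 4).
    by apply: ler_wpM2l => //; exact: addr_ge0.
  have h6 : (K * W) * (phi * l * 3 / 4) <= (u + p) * (phi * l * 3 / 4).
    by apply: ler_wpM2r => //; rewrite !mulr_ge0//; lra.
  have h7 : 0 <= K * W * (phi * l) by exact: mulr_ge0.
  rewrite n00; lra.
Qed.

(** The power is at most [exp (- n A)] and [n <= exp (n A / 8) * (8 / A)]; the remaining
    [exp (- 7 n A / 8)] absorbs both [8 / A] and [1 / delta]. *)
Lemma union_bound_le (n : nat) (A delta : R) :
  0 < A -> A <= 1 / 4 -> 0 < delta -> delta < 1 ->
  16 / A * (ln (8 / A) + ln (1 / delta)) <= n%:R ->
  (1 < n)%N /\ n%:R * (1 - 2 * A) ^+ n.-1 <= delta.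
Proof.
move=> A0 A4 d0 d1 hn.
have L1 : 0 <= ln (1 / delta) by apply: ln_ge0; rewrite ler_pdivlMr// mul1r ltW.
have A8 : 1 <= 8 / A by rewrite ler_pdivlMr//; lra.
have L2 : 1 / 2 <= ln (8 / A).
  have : expR (1 / 2 : R) <= 8 / A.
    have h : (1 / 2 : R) <= expR (- (1 / 2)) by have := @expR_ge1Dx R (- (1 / 2)); lra.
    have : expR (1 / 2 : R) * expR (- (1 / 2)) = 1 by rewrite expRxMexpNx_1.
    have := expR_gt0 (1 / 2 : R); move: h; set E := expR _; set F := expR _ => h E0 EF.
    have F2 : F <= 2 by nra.
    by apply: le_trans F2 _; rewrite ler_pdivlMr//; lra.
  by move=> h; rewrite -ler_expR lnK ?posrE//; lra.
have L : 16 * (ln (8 / A) + ln (1 / delta)) <= n%:R * A.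
  move: hn; rewrite mulrAC ler_pdivrMr//.
have n32 : 32 <= n%:R :> R.
  have : n%:R * A <= n%:R * (1 / 4) :> R by apply: ler_wpM2l.
  lra.
have n2 : (1 < n)%N by rewrite -(ltr_nat R); lra.
split=> //.
have nE : n%:R = n.-1%:R + 1 :> R by rewrite natr1 prednK// ltnW.
have e1 : (1 - 2 * A) ^+ n.-1 <= expR (- (2 * A)) ^+ n.-1.
  apply: lerXn2r; rewrite ?nnegrE ?expR_ge0//; first lra.
  exact: expR_ge1Dx.
(* The factor 2 in [2 * A] pays for having the exponent [n - 1] instead of n. *)
have e2 : expR (- (2 * A)) ^+ n.-1 <= expR (- (n%:R * A)).
  rewrite -expRM_natl ler_expR mulrN lerN2 nE.
  have : 0 <= (n.-1%:R - 1) * A.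
    by rewrite mulr_ge0 ?ltW//; move: n32; rewrite nE; lra.
  lra.
have e3 : n%:R <= expR (n%:R * A / 8) * (8 / A).
  have := expR_ge1Dx (n%:R * A / 8) => h.
  have nA : n%:R = (n%:R * A / 8) * (8 / A) by field; rewrite gt_eqF.
  by rewrite {1}nA; apply: ler_wpM2r; lra.
have e4 : 8 / A = expR (ln (8 / A)) by rewrite lnK// posrE; lra.
have e5 : delta = expR (- ln (1 / delta)).
  by rewrite div1r lnV ?posrE// opprK lnK.
have f0 : 0 <= expR (n%:R * A / 8) * (8 / A) by rewrite mulr_ge0 ?expR_ge0//; lra.
apply: (@le_trans _ _ ((expR (n%:R * A / 8) * (8 / A)) * expR (- (n%:R * A)))).
  apply: ler_pM => //; last exact: le_trans e2.
  by rewrite exprn_ge0//; lra.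
rewrite e4 -!expRD [leRHS]e5 ler_expR.
move: L L1 L2; set x := ln _; set y := ln _; lra.
Qed.

End numeric.

(** * The sweep *)

(** Indices are sorted by decreasing [f]; the order within ties is left open. *)
Lemma exists_sorting_perm (R : realType) (N : nat) (f : 'I_N -> R) :
  exists pi : 'S_N, forall i j : 'I_N, f (pi j) < f (pi i) -> (i < j)%N.
Proof.
pose le := relpre f (fun a b : R => b <= a).
have le_total : total le by move=> i j; exact: le_total.
have le_trans : transitive le by move=> i j k /= h1 h2; exact: le_trans h2 h1.
pose s := sort le (enum 'I_N).
have ss : size s = N by rewrite size_sort size_enum_ord.
have us : uniq s by rewrite sort_uniq enum_uniq.
have sst : sorted le s by exact: sort_sorted.
have ih (i : 'I_N) : (i < size s)%N by rewrite ss.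
pose g (i : 'I_N) := tnth (in_tuple s) (cast_ord (esym ss) i).
have gE x0 (i : 'I_N) : g i = nth x0 s i.
  by rewrite /g (tnth_nth x0).
have gi : injective g.
  move=> i j; rewrite (gE i) (gE i j) => /eqP.
  by rewrite nth_uniq ?ss// => /eqP/val_inj.
exists (perm gi) => i j; rewrite !permE => fij; rewrite ltnNge; apply/negP => ji.
have := sorted_leq_nth le_trans (fun x => lexx (f x)) i sst j i (ih j) (ih i) ji.
by rewrite -!gE /le /= leNgt fij.
Qed.

Section sweep.
Context {R : realType} {d N : nat}.
Variables (r : R) (w : d.-tuple R) (xs : N.-tuple (d.-tuple R)).

(** Holds when j is certain to be + at the update of i: strictly higher sensors have been updated
    already, and any other counts by its initial state. *)
Definition good_vote (s0 : 'I_N -> bool) (i j : 'I_N) :=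
  (dotp w (tnth xs i) < dotp w (tnth xs j)) || s0 j.

Lemma sweep_consensus (s0 : 'I_N -> bool) :
  (forall i, #|[pred j | neighb r xs i j && ~~ good_vote s0 i j]| <
             #|[pred j | neighb r xs i j && good_vote s0 i j]|)%N ->
  consensus_order_exists r xs s0.
Proof.
move=> H; have [pi Hpi] := exists_sorting_perm (fun i => dotp w (tnth xs i)).
exists pi => tb; exists true.
(* Invariant: after the prefix [l1], the updated sensors are + and all others keep their initial
   state. *)
have inv (l1 l2 : seq 'I_N) s : enum 'I_N = l1 ++ l2 ->
    (forall k, s k = (k \in map pi l1) || s0 k) ->
    forall k, foldl (fun s k => update r xs s (pi k) (tb (pi k))) s l2 k =
       (k \in map pi (enum 'I_N)) || s0 k.
  elim: l2 l1 s => [|i l2 IH] l1 s E Hs k /=; first by rewrite E cats0 Hs.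
  apply: (IH (rcons l1 i)); first by rewrite cat_rcons.
  move=> {}k; rewrite map_rcons mem_rcons inE /update.
  case: eqVneq => [->|_] //=.
  have gs j : good_vote s0 (pi i) j -> s j.
    rewrite Hs => /orP[lt_ij|->]; last by rewrite orbT.
    have := Hpi (pi^-1%g j) i; rewrite permKV => /(_ lt_ij) ji.
    apply/orP; left; apply/mapP; exists (pi^-1%g j); last by rewrite permKV.
    have := mem_enum 'I_N (pi^-1%g j); rewrite E mem_cat => /orP[//|].
    have sE : sorted ltn (map val (l1 ++ i :: l2)) by rewrite -E val_enum_ord iota_ltn_sorted.
    move: sE; rewrite map_cat /= => sE.
    have : path ltn i (map val l2).
      by have := drop_sorted (size (map val l1)) sE; rewrite drop_size_cat.
    move=> /(order_path_min ltn_trans)/allP /= il2.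
    rewrite inE => /orP[/eqP jE|/(map_f val)/il2]; first by rewrite jE ltnn in ji.
    by rewrite ltnNge (ltnW ji).
  (* Passing from good votes to actual states can only add + and remove -, so + has a strict
     majority whatever [tb] is. *)
  rewrite /best_response ifT//.
  apply: leq_ltn_trans (leq_trans (H (pi i)) _).
    apply: subset_leq_card; apply/fintype.subsetP => j; rewrite !inE => /andP[-> /=].
    by apply: contra => /gs.
  apply: subset_leq_card; apply/fintype.subsetP => j; rewrite !inE => /andP[-> /=].
  exact: gs.
move=> i; rewrite /async_run (inv [::] (enum 'I_N) s0)//.
by rewrite (_ : _ \in _)//; apply/mapP; exists (pi^-1%g i); rewrite ?mem_enum ?permKV.
Qed.

End sweep.

(** * Votes and the union bound *)

Section integral_facts.
Local Open Scope ereal_scope.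
Context {R : realType} {dT : measure_display} {T : measurableType dT}.
Variable mu : {measure set T -> \bar R}.

(** [f] and [g] need not be measurable, which spares proving that the set of
positions and states admitting a consensus order is measurable. *)
Lemma ge0_le_integralT (f g : T -> \bar R) :
  (forall x, 0 <= f x) -> (forall x, f x <= g x) ->
  \int[mu]_x f x <= \int[mu]_x g x.
Proof.
move=> f0 fg.
have g0 x : 0 <= g x by exact: le_trans (f0 x) (fg x).
rewrite (ge0_integralTE mu f0) (ge0_integralTE mu g0).
apply: le_ereal_sup => _ [h hf <-]; exists h => // x.
exact: le_trans (hf x) (fg x).
Qed.

Lemma integral_pred_comb4 (b0 b1 b2 b3 : T -> bool) (m0 m1 m2 m3 c0 c1 c2 c3 : R) :
  measurable_fun setT b0 -> measurable_fun setT b1 ->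
  measurable_fun setT b2 -> measurable_fun setT b3 ->
  mu [set x | b0 x] = m0%:E -> mu [set x | b1 x] = m1%:E ->
  mu [set x | b2 x] = m2%:E -> mu [set x | b3 x] = m3%:E ->
  (0 <= c0)%R -> (0 <= c1)%R -> (0 <= c2)%R -> (0 <= c3)%R ->
  \int[mu]_x (c0 * (b0 x)%:R + c1 * (b1 x)%:R + c2 * (b2 x)%:R + c3 * (b3 x)%:R)%:E
  = (c0 * m0 + c1 * m1 + c2 * m2 + c3 * m3)%:E.
Proof.
move=> mb0 mb1 mb2 mb3 e0 e1 e2 e3 c00 c10 c20 c30.
have term (b : T -> bool) c m : measurable_fun setT b -> mu [set x | b x] = m%:E ->
    (0 <= c)%R -> [/\ measurable_fun setT (fun x => (c * (b x)%:R)%:E),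
      forall x, 0 <= (c * (b x)%:R)%:E & \int[mu]_x (c * (b x)%:R)%:E = (c * m)%:E].
  move=> mb bm c_ge0; have mn := @measurable_natr_pred R _ _ b mb.
  split.
  - by apply/measurable_EFinP; apply: measurable_funM.
  - by move=> x; rewrite lee_fin mulr_ge0.
  - under eq_integral do rewrite EFinM.
    rewrite ge0_integralZl//; first by rewrite integral_natr_pred// bm.
    exact/measurable_EFinP.
have [M0 P0 I0] := term _ _ _ mb0 e0 c00.
have [M1 P1 I1] := term _ _ _ mb1 e1 c10.
have [M2 P2 I2] := term _ _ _ mb2 e2 c20.
have [M3 P3 I3] := term _ _ _ mb3 e3 c30.
under eq_integral do rewrite !EFinD.
rewrite ge0_integralD//; last 2 first.
- by move=> x _; rewrite !adde_ge0.
- by do 2!apply: emeasurable_funD => //.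
rewrite ge0_integralD//; last 2 first.
- by move=> x _; rewrite !adde_ge0.
- by apply: emeasurable_funD => //.
by rewrite ge0_integralD// I0 I1 I2 I3 !EFinD.
Qed.

End integral_facts.

(** * Expected exponential of a single vote *)

Section kernel.
Context {R : realType} {d : nat}.
Variables (r eta l : R) (w : d.-tuple R).
Local Notation lam := (@lebesgue_d R d).
Local Notation Rd := (d.-tuple R).
Local Notation ball := [set x : Rd | dotp x x <= 1].

Definition inball (x : Rd) := dotp x x <= 1.

Definition far (x y : Rd) := inball y && ~~ nbr r x y.

(** Values of [E exp (- l Z)] on the parts: on U the vote is surely +, on P it is + with probability
    [1 - eta], on Q with probability [eta]. *)
Definition voteU : R := expR (- l).
Definition voteP : R := (1 - eta) * expR (- l) + eta * expR l.
Definition voteN : R := eta * expR (- l) + (1 - eta) * expR l.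

(** [E exp (- l Z)] for the vote Z on [x] of a sensor at a fixed position [y] of the
unit ball, over the noise at [y]; zero for [y] outside the unit ball. *)
Definition vote (x y : Rd) : R :=
  1 * (far x y)%:R + voteU * (nbrU r w x y)%:R
  + voteP * (nbrP r w x y)%:R + voteN * (nbrN r w x y)%:R.

Lemma measurable_inball dT (T : measurableType dT) (f : T -> Rd) :
  measurable_fun setT f -> measurable_fun setT (fun t => inball (f t)).
Proof. by move=> mf; apply: measurable_fun_ler => //; exact: measurable_dotp. Qed.

Lemma measurable_far dT (T : measurableType dT) (f g : T -> Rd) :
  measurable_fun setT f -> measurable_fun setT g ->
  measurable_fun setT (fun t => far (f t) (g t)).
Proof.
move=> mf mg; apply: measurable_and; first exact: measurable_inball.
by apply: measurable_neg; exact: measurable_nbr.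
Qed.

Lemma measurable_nbrU dT (T : measurableType dT) (f g : T -> Rd) :
  measurable_fun setT f -> measurable_fun setT g ->
  measurable_fun setT (fun t => nbrU r w (f t) (g t)).
Proof.
by move=> mf mg; apply: measurable_and; [exact: measurable_nbr|exact: measurable_above].
Qed.

Lemma measurable_nbrP dT (T : measurableType dT) (f g : T -> Rd) :
  measurable_fun setT f -> measurable_fun setT g ->
  measurable_fun setT (fun t => nbrP r w (f t) (g t)).
Proof.
move=> mf mg; apply: measurable_and; first exact: measurable_nbr.
apply: measurable_and; last exact: measurable_halfspace.
by apply: measurable_neg; exact: measurable_above.
Qed.

Lemma measurable_nbrN dT (T : measurableType dT) (f g : T -> Rd) :
  measurable_fun setT f -> measurable_fun setT g ->
  measurable_fun setT (fun t => nbrN r w (f t) (g t)).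
Proof.
move=> mf mg; apply: measurable_and; first exact: measurable_nbr.
apply: measurable_and; apply: measurable_neg; first exact: measurable_above.
exact: measurable_halfspace.
Qed.

Lemma measurable_vote dT (T : measurableType dT) (f g : T -> Rd) :
  measurable_fun setT f -> measurable_fun setT g ->
  measurable_fun setT (fun t => vote (f t) (g t)).
Proof.
move=> mf mg.
have mc (c : R) (b : T -> bool) : measurable_fun setT b ->
    measurable_fun setT (fun t => c * (b t)%:R).
  by move=> mb; apply: measurable_funM => //; exact: measurable_natr_pred.
repeat apply: measurable_funD; apply: mc.
- exact: measurable_far.
- exact: measurable_nbrU.
- exact: measurable_nbrP.
- exact: measurable_nbrN.
Qed.

Hypotheses (eta0 : 0 <= eta) (eta1 : eta <= 1).

Lemma vote_ge0 x y : 0 <= vote x y.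
Proof.
by rewrite /vote /voteU /voteP /voteN !addr_ge0// ?mulr_ge0// ?addr_ge0// ?mulr_ge0//
  ?expR_ge0// subr_ge0.
Qed.

Lemma inball_split x y : inball y ->
  1 * (far x y)%:R + 1 * (nbrU r w x y)%:R + 1 * (nbrP r w x y)%:R
    + 1 * (nbrN r w x y)%:R = 1 :> R.
Proof.
rewrite /far /nbrU /nbrP /nbrN => ->; case: (nbr r x y); case: (above w x y);
  case: (0 <= dotp w y); rewrite /=; lra.
Qed.

Lemma notinball_split x y : ~~ inball y ->
  [/\ far x y = false, nbrU r w x y = false, nbrP r w x y = false
    & nbrN r w x y = false].
Proof. by rewrite /far /nbrU /nbrP /nbrN /nbr /inball => /negbTE ->. Qed.

End kernel.

(** * Integral of a vote over the position of the voter *)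

Section gain.
Context {R : realType} {d : nat}.
Variables (r eta phi : R) (w : d.-tuple R).
Local Notation lam := (@lebesgue_d R d).
Local Notation Rd := (d.-tuple R).
Local Notation ball := [set x : Rd | dotp x x <= 1].
Local Notation K := ((1 / 32) ^+ d : R).
Local Notation l := (phi * K / 4).

(** Apply [weighted_gain] with [W = r ^ d * v], which bounds the neighbourhood from above; a ball of
    radius [r / 32] has volume [K * W]. *)
Lemma integral_vote_le (x : Rd) (v : R) : (0 < d)%N -> 0 < r -> r <= 1 / 2 ->
  0 < phi -> phi <= eta -> phi <= 1 / 2 - eta -> dotp w w = 1 ->
  lam ball = v%:E -> dotp x x <= 1 ->
  (\int[lam]_y (vote r eta l w x y)%:E
    <= (v * (1 - phi ^+ 2 * K ^+ 2 * r ^+ d / 8))%:E)%E.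
Proof.
move=> d0 r0 r2 phi0 phe phh w1 vE xx.
have mid : measurable_fun [set: Rd] id by [].
have mc (u : Rd) : measurable_fun [set: Rd] (fun=> u) by [].
have mF : measurable_fun [set: Rd] (far r x) by exact: measurable_far.
have mU : measurable_fun [set: Rd] (nbrU r w x) by exact: measurable_nbrU.
have mP : measurable_fun [set: Rd] (nbrP r w x) by exact: measurable_nbrP.
have mN : measurable_fun [set: Rd] (nbrN r w x) by exact: measurable_nbrN.
have finE (b : Rd -> bool) : measurable_fun [set: Rd] b ->
    (forall y, b y -> dotp y y <= 1) ->
    lam [set y | b y] = (fine (lam [set y | b y]))%:E /\ 0 <= fine (lam [set y | b y]).
  move=> mb bb; split; last by rewrite fine_ge0.
  rewrite fineK// ge0_fin_numE//; apply: le_lt_trans (@lebesgue_d_ball_fin R d).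
  have mbs := measurable_pred mb.
  have mB := @measurable_unit_ball R d.
  have bB : [set y | b y] `<=` ball by move=> y; exact: bb.
  by apply: le_measure; rewrite ?inE.
have [FE F0] := finE _ mF (fun y (h : far r x y) => proj1 (andP h)).
have [UE U0] := finE _ mU (fun y (h : nbrU r w x y) => proj1 (andP (proj1 (andP h)))).
have [PE P0] := finE _ mP (fun y (h : nbrP r w x y) => proj1 (andP (proj1 (andP h)))).
have [NE N0] := finE _ mN (fun y (h : nbrN r w x y) => proj1 (andP (proj1 (andP h)))).
move: FE F0 UE U0 PE P0 NE N0.
set f := fine (lam [set y | far r x y]); set u := fine (lam [set y | nbrU r w x y]).
set p := fine (lam [set y | nbrP r w x y]); set n := fine (lam [set y | nbrN r w x y]).
move=> FE F0 UE U0 PE P0 NE N0.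
have comb c0 c1 c2 c3 := @integral_pred_comb4 R _ _ lam _ _ _ _ f u p n c0 c1 c2 c3
  mF mU mP mN FE UE PE NE.
have v_sum : v = f + u + p + n.
  (* The integral formula with unit coefficients gives the volume of the ball. *)
  have := comb 1 1 1 1 ler01 ler01 ler01 ler01; rewrite !mul1r => h.
  apply: EFin_inj; rewrite -h -vE.
  have mb : measurable_fun [set: Rd] inball by exact: measurable_inball.
  rewrite -(integral_natr_pred lam mb); apply: eq_integral => y _; congr EFin.
  have [yb|yb] := boolP (inball y).
    by have := inball_split r w x yb; rewrite !mul1r => ->.
  by have [-> -> -> ->] := notinball_split r w x yb; rewrite !mulr0 !addr0.
have V_sum : lam [set y | nbr r x y] = (u + p + n)%:E.
  have mnb : measurable_fun [set: Rd] (nbr r x) by exact: measurable_nbr.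
  have := comb 0 1 1 1 (lexx 0) ler01 ler01 ler01; rewrite !mul0r !mul1r add0r => <-.
  rewrite -(integral_natr_pred lam mnb); apply: eq_integral => y _; congr EFin.
  rewrite /nbrU /nbrP /nbrN; case: (nbr r x y); case: (above w x y);
    case: (0 <= dotp w y); rewrite /=; lra.
have l0 : 0 < K by rewrite exprn_gt0//; lra.
have K1 : K <= 1 by rewrite exprn_ile1//; lra.
have -> : (\int[lam]_y (vote r eta l w x y)%:E =
   (1 * f + voteU l * u + voteP eta l * p + voteN eta l * n)%:E)%E.
  by apply: comb => //; rewrite /voteU /voteP /voteN ?addr_ge0 ?mulr_ge0 ?expR_ge0//; lra.
rewrite lee_fin.
have W : u + p + n <= r ^+ d * v.
  by rewrite -lee_fin -V_sum EFinM -vE; exact: nbr_le.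
have KrE : (r / 32) ^+ d * v = K * (r ^+ d * v).
  by rewrite mulrA -exprMn; congr (_ ^+ d * v); field.
have H : (K * (r ^+ d * v) <= u /\ n <= u + p) \/
    (n = 0 /\ K * (r ^+ d * v) <= u + p).
  have [wx|wx] := leP (dotp w x) (1 / 2).
    left; rewrite -KrE -!lee_fin EFinM -vE -UE EFinD -UE -PE -NE.
    by split; [exact: nbrU_ge|exact: nbrN_le].
  right; have n0 : n = 0.
    by apply: EFin_inj; rewrite -NE (nbrN_empty r0 r2 w1 wx) measure0.
  split=> //; have := nbr_ge r0 r2 xx.
  by rewrite V_sum n0 addr0 vE -EFinM lee_fin KrE.
have := weighted_gain U0 P0 N0 W l0 K1 phi0 phe phh H.
rewrite /voteU /voteP /voteN v_sum.
set a := expR _; set b := expR _; set X := _ * _ / 8 * _ => h.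
have -> : (f + u + p + n) * (1 - phi ^+ 2 * K ^+ 2 * r ^+ d / 8) =
  (f + u + p + n) - X by rewrite /X; field.
by clearbody X a b; lra.
Qed.

End gain.

(** * Chernoff and union bounds over the noise, at fixed positions *)

Section chernoff.
Context {R : realType} {d N : nat}.
Variables (r eta l : R) (w : d.-tuple R) (xs : N.-tuple (d.-tuple R)).
Hypotheses (r0 : 0 <= r) (eta0 : 0 <= eta) (eta1 : eta <= 1) (l0 : 0 <= l).
Hypothesis xsb : forall i, inball (tnth xs i).

Definition label_weight (j : 'I_N) (b : bool) : R :=
  if b == target w (tnth xs j) then 1 - eta else eta.

Lemma label_weight_ge0 j b : 0 <= label_weight j b.
Proof. by rewrite /label_weight; case: ifP => _ //; rewrite subr_ge0. Qed.

Lemma sum_label_weight j : \sum_(b : bool) label_weight j b = 1.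
Proof. by rewrite big_bool /label_weight; case: target => /=; ring. Qed.

(** The value of [exp (- l Z)] for the vote of j on i when j starts in state b. *)
Definition exp_vote (i j : 'I_N) (b : bool) : R :=
  if neighb r xs i j then
    if (dotp w (tnth xs i) < dotp w (tnth xs j)) || b then expR (- l) else expR l
  else 1.

Lemma sum_exp_vote i j : j != i ->
  \sum_(b : bool) label_weight j b * exp_vote i j b =
  vote r eta l w (tnth xs i) (tnth xs j).
Proof.
move=> ji; rewrite big_bool /= /label_weight /exp_vote /neighb (eq_sym i j) ji edist_le//=.
rewrite /vote /far /nbrU /nbrP /nbrN /nbr -/(inball _) xsb /= /above /target
  /voteU /voteP /voteN.
case: (sqdist _ _ <= _); case: (_ < _); case: (0 <= _); rewrite /=; ring.
Qed.

Lemma noise_weight_ge0 s0 : 0 <= noise_weight eta w xs s0.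
Proof. by apply: prodr_ge0 => i _; exact: label_weight_ge0. Qed.

Lemma sum_noise_weight : \sum_(s0 : {ffun 'I_N -> bool}) noise_weight eta w xs s0 = 1.
Proof.
rewrite /noise_weight -(bigA_distr_bigA label_weight).
by rewrite big1// => i _; exact: sum_label_weight.
Qed.

(** Independence of the initial states: the sum over all state vectors factors by distributivity,
    and sensor i contributes 1. *)
Lemma sum_noise_exp_vote i :
  \sum_(s0 : {ffun 'I_N -> bool}) noise_weight eta w xs s0 *
    \prod_(j < N | j != i) exp_vote i j (s0 j) =
  \prod_(j < N | j != i) vote r eta l w (tnth xs i) (tnth xs j).
Proof.
under eq_bigr => s0 _.
  rewrite [X in _ * X]big_mkcond /noise_weight -big_split /=.
  over.
rewrite -(bigA_distr_bigA (fun j b =>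
  label_weight j b * (if j != i then exp_vote i j b else 1))).
rewrite [RHS]big_mkcond; apply: eq_bigr => j _; case: ifPn => ji.
  exact: sum_exp_vote.
by under eq_bigr do rewrite mulr1; exact: sum_label_weight.
Qed.

(** The product is [exp (l * (bad - good))] in terms of the vote counts; this is the Markov step of
    the Chernoff bound. *)
Lemma prod_exp_vote_ge1 (s0 : 'I_N -> bool) i :
  (#|[pred j | neighb r xs i j && good_vote w xs s0 i j]| <=
   #|[pred j | neighb r xs i j && ~~ good_vote w xs s0 i j]|)%N ->
  1 <= \prod_(j < N | j != i) exp_vote i j (s0 j).
Proof.
move=> H.
have -> : \prod_(j < N | j != i) exp_vote i j (s0 j) =
  expR (- l) ^+ #|[pred j | neighb r xs i j && good_vote w xs s0 i j]| *
  expR l ^+ #|[pred j | neighb r xs i j && ~~ good_vote w xs s0 i j]|.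
  rewrite -!prodr_const [RHS]mulrC.
  rewrite big_mkcond [X in _ = X * _]big_mkcond [X in _ = _ * X]big_mkcond -big_split /=.
  apply: eq_bigr => j _; rewrite /exp_vote /good_vote !inE /neighb eq_sym.
  case: (i != j) => //=; rewrite ?mulr1//.
  case: (_ <= r); rewrite /= ?mulr1//.
  by case: (_ || _); rewrite /= ?mul1r ?mulr1.
rewrite -(subnK H) exprD mulrCA -exprMn -expRD addNr expR0 expr1n mulr1.
by apply: exprn_ege1; rewrite -expR0 ler_expR.
Qed.

(** For each [s0] without a consensus order, [sweep_consensus] yields a failing sensor, whose
    product is at least 1; so the indicator of consensus is at least 1 minus the sum of the
    products. *)
Lemma consensus_weight_ge :
  1 - \sum_(i < N) \prod_(j < N | j != i) vote r eta l w (tnth xs i) (tnth xs j) <=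
  \sum_(s0 : {ffun 'I_N -> bool}) noise_weight eta w xs s0 *
    (if `[< consensus_order_exists r xs s0 >] then 1 else 0).
Proof.
under eq_bigr do rewrite -sum_noise_exp_vote.
rewrite exchange_big /= -{1}sum_noise_weight -sumrB; apply: ler_sum => s0 _.
rewrite -mulr_sumr -{1}(mulr1 (noise_weight _ _ _ _)) -mulrBr.
apply: ler_wpM2l; first exact: noise_weight_ge0.
have P0 i : 0 <= \prod_(j < N | j != i) exp_vote i j (s0 j).
  apply: prodr_ge0 => j _; rewrite /exp_vote; case: ifP => // _.
  by case: ifP => _; exact: expR_ge0.
case: asboolP => [_|nc]; first by rewrite lerBlDr lerDl sumr_ge0.
rewrite subr_le0.
have [i Hi] : exists i, (#|[pred j | neighb r xs i j && good_vote w xs s0 i j]| <=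
   #|[pred j | neighb r xs i j && ~~ good_vote w xs s0 i j]|)%N.
  apply: contrapT => nex; apply: nc; apply: (sweep_consensus (w := w)) => i.
  by rewrite ltnNge; apply/negP => Hi; apply: nex; exists i.
apply: le_trans (prod_exp_vote_ge1 Hi) _.
by rewrite [leRHS](bigD1 i)//= lerDl sumr_ge0.
Qed.

End chernoff.

(** * Integration over the positions *)

Section probability_bound.
Context {R : realType} {d n : nat}.
Variables (r eta l : R) (w : d.-tuple R).
Local Notation lam := (@lebesgue_d R d).
Local Notation Rd := (d.-tuple R).
Local Notation ball := [set x : Rd | dotp x x <= 1].
Local Notation N := n.+1.

Lemma prob_consensus_ge (v g : R) :
  0 <= r -> 0 <= eta -> eta <= 1 -> 0 <= l -> 0 < v -> 0 <= g ->
  lam ball = v%:E ->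
  (forall x, inball x -> (\int[lam]_y (vote r eta l w x y)%:E <= (v * g)%:E)%E) ->
  ((1 - N%:R * g ^+ n)%:E <= prob_consensus N r eta w)%E.
Proof.
move=> r0 eta0 eta1 l0 v0 g0 vE Hg; rewrite /prob_consensus.
have -> : @unit_ball R d = ball by apply: eq_set => x; rewrite /unit_ball enorm_le1.
rewrite vE /=.
pose Pn : {measure set (N.-tuple Rd) -> \bar R} := @iprod _ _ _ lam N.
pose F (xs : N.-tuple Rd) : R := \sum_(s0 : {ffun 'I_N -> bool}) noise_weight eta w xs s0 *
    (if `[< consensus_order_exists r xs s0 >] then 1 else 0).
have F0 xs : 0 <= F xs.
  apply: sumr_ge0 => s0 _; apply: mulr_ge0; first exact: noise_weight_ge0.
  by case: ifP.
pose D := [set xs : N.-tuple Rd | forall i : 'I_N, ball (tnth xs i)].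
suff H : ((v ^+ N * (1 - N%:R * g ^+ n))%:E <= \int[Pn]_(xs in D) (F xs)%:E)%E.
  have vN : 0 < v ^+ N by exact: exprn_gt0.
  have -> : (1 - N%:R * g ^+ n)%:E =
      ((v ^+ N * (1 - N%:R * g ^+ n))%:E * ((v ^+ N)^-1)%:E)%E.
    by rewrite -EFinM; congr EFin; field; rewrite gt_eqF.
  by apply: lee_wpmul2r => //; rewrite lee_fin invr_ge0 ltW.
pose a (x : Rd) : R := (inball x)%:R.
(* The factor [a z.1] makes the kernel vanish for x outside the ball, so that its integral bound
   holds for every x. *)
pose k (z : Rd * Rd) : R := a z.1 * vote r eta l w z.1 z.2.
pose p (xs : N.-tuple Rd) : R := \prod_(i < N) a (tnth xs i).
pose S (xs : N.-tuple Rd) : R :=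
  \sum_(i < N) a (tnth xs i) * \prod_(j < N | j != i) k (tnth xs i, tnth xs j).
(* A measurable minorant of the integrand: the positive part keeps it nonnegative, and it is zero
   outside [D]. *)
pose G (xs : N.-tuple Rd) : R := Num.max 0 (p xs - S xs).
have a0 x : 0 <= a x by rewrite /a.
have k0 z : 0 <= k z by rewrite /k mulr_ge0// vote_ge0.
have p0 xs : 0 <= p xs by exact: prodr_ge0.
have S0 xs : 0 <= S xs.
  by apply: sumr_ge0 => i _; rewrite mulr_ge0// prodr_ge0.
have G0 xs : 0 <= G xs by rewrite le_max lexx.
have mid : measurable_fun [set: Rd] id by [].
have ma : measurable_fun [set: Rd] a by apply: measurable_natr_pred; exact: measurable_inball.
have mk : measurable_fun [set: Rd * Rd] k.
  apply: measurable_funM; last exact: measurable_vote.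
  by apply: measurable_natr_pred; exact: measurable_inball.
have mp : measurable_fun [set: N.-tuple Rd] p by exact: measurable_prod_tnth.
have mSi (i : 'I_N) := measurable_kernel_prod (n := N) i ma mk.
have mS : measurable_fun [set: N.-tuple Rd] S by exact: measurable_sum.
have mG : measurable_fun [set: N.-tuple Rd] G.
  by apply: measurable_maxr => //; exact: measurable_funB.
have pE xs : D xs -> p xs = 1.
  by move=> Dxs; rewrite /p big1// => i _; rewrite /a /inball (Dxs i).
have pE0 xs : ~ D xs -> p xs = 0.
  move=> nD; have [i ni] : exists i, ~ ball (tnth xs i) by apply/existsNP.
  by rewrite /p (bigD1 i)//= /a /inball (negbTE (introN idP ni)) mul0r.
have Ia : (\int[lam]_x (a x)%:E = v%:E)%E.
  by rewrite integral_natr_pred//; exact: measurable_inball.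
have Ip : (\int[Pn]_xs (p xs)%:E = (v ^+ N)%:E)%E.
  exact: (integral_iprod_prod N ma a0 Ia).
have kQ x : (\int[lam]_y (k (x, y))%:E <= (v * g)%:E)%E.
  rewrite /k /a /=; have [xb|xb] := boolP (inball x).
    by under eq_integral do rewrite mul1r; exact: Hg.
  under eq_integral do rewrite mul0r.
  by rewrite integral0 lee_fin mulr_ge0// ltW.
have IS : (\int[Pn]_xs (S xs)%:E <= (N%:R * (v * (v * g) ^+ n))%:E)%E.
  rewrite /S; under eq_integral do rewrite -sumEFin.
  rewrite ge0_integral_sum//; last 2 first.
  - by move=> i; apply/measurable_EFinP; exact: mSi.
  - by move=> i xs _; rewrite lee_fin mulr_ge0// prodr_ge0.
  have -> : (N%:R * (v * (v * g) ^+ n))%:E = (\sum_(i < N) (v * (v * g) ^+ n)%:E)%E.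
    by rewrite sumEFin sumr_const card_ord mulr_natl.
  apply: lee_sum => i _; exact: (integral_iprod_kernel_le i ma a0 mk k0 kQ Ia).
have GF xs : ((G xs)%:E <= ((fun xs => (F xs)%:E) \_ D) xs)%E.
  rewrite patchE; case: ifPn => [/set_mem Dxs|/negP nD].
    rewrite lee_fin ge_max F0 pE//=.
    have := @consensus_weight_ge R d N r eta l w xs r0 eta0 eta1 l0 Dxs.
    congr (1 - _ <= _); apply: eq_bigr => i _.
    have ai j : a (tnth xs j) = 1 by rewrite /a /inball (Dxs j).
    by rewrite ai mul1r; apply: eq_bigr => j _; rewrite /k /= ai mul1r.
  rewrite lee_fin ge_max lexx pE0 ?sub0r ?oppr_le0//=.
  by move=> Dxs; apply: nD; rewrite inE.
rewrite integral_mkcond.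
apply: (@le_trans _ _ (\int[Pn]_xs (G xs)%:E)%E); last first.
  by apply: ge0_le_integralT => // xs; rewrite lee_fin.
(* Stated as a sum of nonnegative functions, so that no difference of integrals is involved. *)
have pGS : (\int[Pn]_xs (p xs)%:E <= \int[Pn]_xs (G xs)%:E + \int[Pn]_xs (S xs)%:E)%E.
  rewrite -ge0_integralD//; last 4 first.
  - by move=> xs _; rewrite lee_fin.
  - exact/measurable_EFinP.
  - by move=> xs _; rewrite lee_fin.
  - exact/measurable_EFinP.
  apply: ge0_le_integralT => xs; rewrite ?lee_fin//.
  by rewrite -lerBlDr le_max lexx orbT.
have : ((v ^+ N)%:E <= \int[Pn]_xs (G xs)%:E + (N%:R * (v * (v * g) ^+ n))%:E)%E.
  by rewrite -Ip; apply: le_trans pGS _; exact: leeD.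
rewrite -leeBlDr// -EFinB; congr (_ <= _)%E; congr EFin.
by rewrite exprMn exprS; ring.
Qed.

End probability_bound.

(** * Choice of the constant and conclusion *)

Theorem theorem3 (R : realType) :
  exists c : R, 0 < c /\
  forall (d N : nat) (r eta delta : R) (w : d.-tuple R),
    (1 <= d)%N ->
    0 < r -> r <= 1 / 2 ->
    0 < eta -> eta < 1 / 2 ->
    0 < delta -> delta < 1 ->
    enorm w = 1 ->
    16 / ((c * r) ^+ d * (Num.min eta (1 / 2 - eta)) ^+ 2)
      * (ln (8 / ((c * r) ^+ d * (Num.min eta (1 / 2 - eta)) ^+ 2))
         + ln (1 / delta))
      <= N%:R ->
    ((1 - delta)%:E <= prob_consensus N r eta w)%E.
Proof.
(* [(1 / 32) ^ 2] produces [K ^ 2] in [(c * r) ^ d]; since [d >= 1], the factor [(1 / 16) ^ d] is at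
   most [1 / 16], which turns the gain with denominator 8 into [2 * A]. *)
pose c : R := 1 / 16 * (1 / 32) ^+ 2.
have c0 : 0 < c by rewrite mulr_gt0 ?exprn_gt0 ?divr_gt0 ?ltr0n.
have c1 : c <= 1 by rewrite mulr_ile1 ?exprn_ge0 ?exprn_ile1//; lra.
exists c; split=> //.
move=> d N r eta delta w d1 r0 r2 eta0 eta2 delta0 delta1 w1.
set phi := Num.min eta (1 / 2 - eta); set A := _ * phi ^+ 2 => hN.
have phi0 : 0 < phi by rewrite lt_min eta0 subr_gt0.
have phe : phi <= eta by rewrite ge_min lexx.
have phh : phi <= 1 / 2 - eta by rewrite ge_min lexx orbT.
have cr0 : 0 < c * r by exact: mulr_gt0.
have crd0 : 0 < (c * r) ^+ d by exact: exprn_gt0.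
have A0 : 0 < A by rewrite mulr_gt0// exprn_gt0.
have crd1 : (c * r) ^+ d <= 1.
  by rewrite exprn_ile1 ?(ltW cr0)// mulr_ile1 ?(ltW c0) ?(ltW r0)//; lra.
have phi2 : phi ^+ 2 <= 1 / 16 by have : phi <= 1 / 4; [lra|nra].
have A4 : A <= 1 / 4.
  apply: (@le_trans _ _ (1 * (1 / 16))); last lra.
  by apply: ler_pM => //; [exact: ltW|exact: sqr_ge0].
have [N1 hd] := union_bound_le A0 A4 delta0 delta1 hN.
(* N is at least 2, so it can be written [n.+1], n being the number of voters on a given sensor. *)
case: N N1 hN hd => // n _ _ /= hd.
have ww := enorm_eq1 w1.
have vfin : lebesgue_d [set x : d.-tuple R | dotp x x <= 1] \is a fin_num.
  by rewrite ge0_fin_numE//; exact: lebesgue_d_ball_fin.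
have vE := esym (fineK vfin); set v := fine _ in vE.
have v0 : 0 < v by rewrite -lte_fin -vE; exact: lebesgue_d_ball_gt0.
pose K : R := (1 / 32) ^+ d.
have K0 : 0 < K by rewrite exprn_gt0//; lra.
have gain : 2 * A <= phi ^+ 2 * K ^+ 2 * r ^+ d / 8.
  have -> : A = (1 / 16) ^+ d * (phi ^+ 2 * K ^+ 2 * r ^+ d).
    have crdE : (c * r) ^+ d = (1 / 16) ^+ d * K ^+ 2 * r ^+ d.
      by rewrite /K -exprM mulnC exprM -!exprMn.
    by rewrite /A crdE; set a := _ ^+ d; set b := r ^+ d; ring.
  have : (1 / 16 : R) ^+ d <= 1 / 16.
    by rewrite -{2}(expr1 (1 / 16 : R)); apply: ler_wiXn2l => //; lra.
  have X0 : 0 <= phi ^+ 2 * K ^+ 2 * r ^+ d.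
    by rewrite !mulr_ge0 ?exprn_ge0 ?(ltW K0) ?(ltW phi0) ?(ltW r0).
  move=> h; have := ler_wpM2r X0 h; lra.
have l0 : 0 <= phi * K / 4 by rewrite divr_ge0// mulr_ge0// ltW.
apply: le_trans (prob_consensus_ge (l := phi * K / 4) (v := v)
  (g := 1 - 2 * A) (n := n) (ltW r0) (ltW eta0) _ l0 v0 _ vE _).
- by rewrite lee_fin; lra.
- lra.
- lra.
move=> x xb.
apply: le_trans (integral_vote_le d1 r0 r2 phi0 phe phh ww vE xb) _.
by rewrite lee_fin ler_pM2l// -/K; lra.
Qed.
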